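(* (i) Let $N\subset M$ be a spin model subfactor of even index $[M:N]=2n$ with $n\ge3$, and let $0<t<\frac12$ satisfy $t(1-t)=[M:N]^{-1}$. Then for each integer $0\le i\le 2n-4$ there is an increasing sequence $\{\alpha_m^{(i)}\}_{m\ge1}$ in $\Lambda(M,N)\cap(t,1-t)$ with limit point $\frac{2+i}{[M:N]}$. (ii) Let $N\subset M$ be a vertex model subfactor of index $[M:N]=(2n)^2$ with $n\ge3$, and let $0<t<\frac12$ satisfy $t(1-t)=[M:N]^{-1}$. Then for each integer $0\le i\le2n-4$ there is an increasing sequence $\{\beta_m^{(i)}\}_{m\ge1}$ in $\Lambda(M,N)\cap(t,1-t)$ with limit point $\frac{2+i}{\sqrt{[M:N]}}$.
   Context: For a subfactor $N\subset M$ of type $II_1$ factors, $E_N=E^M_N$ is the unique trace-preserving conditional expectation of $M$ onto $N$, $\mathcal P(M)$ is the set of projections of $M$, and $\Lambda(M,N):=\{\alpha\in[0,1]: E_N(p)=\alpha 1 \text{ for some } p\in\mathcal P(M)\}$. Notation: $M_n=M_n(\mathbb C)$ for full matrix algebras, $\mathrm{Ad}_u(x)=uxu^*$, and $\langle\mathcal A,x\rangle$ is the subalgebra generated by $\mathcal A$ and $x$. Spin model subfactor: let $u$ be an $n\times n$ complex Hadamard matrix (normalized to be unitary, all entries of modulus $1/\sqrt n$) and let $\Delta_n\subset M_n$ be the diagonal subalgebra. Put $A_0=\Delta_n\subset A_1=M_n$ and $B_0=\mathbb C\subset B_1=\mathrm{Ad}_u(\Delta_n)$; the quadruple $(B_0\subset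 A_0,B_1\subset A_1)$ is a non-degenerate commuting square with respect to the normalized trace. For $k\ge1$ let $A_{k+1}=\langle A_k,e_{k+1}\rangle$ be the basic construction of $A_{k-1}\subset A_k$ with Jones projection $e_{k+1}$, with respect to the Markov trace, and let $B_{k+1}=\langle B_k,e_{k+1}\rangle\subset A_{k+1}$. The spin model subfactor $R_u\subset R$ is $R_u=\overline{\bigcup_kB_k}\subset R=\overline{\bigcup_kA_k}$, the weak closures being taken in the GNS representation of the (Markov) trace on $\bigcup_kA_k$. It is an inclusion of $II_1$ factors with $[R:R_u]=n$. Vertex model subfactor: a unitary $w=(w_{\alpha a}^{\beta b})\in M_n\otimes M_k$ ($1\le\alpha,\beta\le n$, $1\le a,b\le k$) is bi-unitary if its block transpose $\widetilde w=(\widetilde w_{\alpha a}^{\beta b})$, $\widetilde w_{\alpha a}^{\beta b}:=w_{\beta a}^{\alpha b}$, is also unitary in $M_n\otimes M_k$. For a bi-unitary $v\in M_n\otimes M_k$, apply the same procedure to the non-degenerate commuting square given by $A_0=\mathbb C\otimes M_k\subset A_1=M_n\otimes M_k$ and $B_0=\mathbb C\subset B_1=\mathrm{Ad}_v(M_n\otimes\mathbb C)$. The resulting inclusion $R_v\subset R$ of $II_1$ factors is the vertex model subfactor, and $[R:R_v]=k^2$. *)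

(* Defs.v *)
From HB Require Import structures.
From mathcomp Require Import all_boot all_order all_algebra.
From mathcomp Require Import all_classical all_reals all_analysis.
From mathcomp Require Import complex.
From mathcomp Require mxtens.

Set Implicit Arguments.
Unset Strict Implicit.
Unset Printing Implicit Defensive.
Import Order.TTheory GRing.Theory Num.Theory.
Import numFieldNormedType.Exports.
Local Open Scope classical_set_scope.
Local Open Scope ring_scope.

(* A complex Hilbert space is a complete normed module H over R[i] whose norm
   comes from an inner product (linear in the first variable). *)
Definition norm_of_dot (R : realType) (H : completeNormedModType R[i])
    (dot : {dot H for (@Num.conj R[i])}) : Prop :=
  forall x : H, `|x| ^+ 2 = dot x x.

Section Operators.
Variables (R : realType) (H : completeNormedModType R[i]).
Variable dot : {dot H for (@Num.conj R[i])}.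

Definition op : Type := H -> H.

Definition bounded_op (f : op) : Prop := linear f /\ continuous f.

Definition adjoint_op (f g : op) : Prop :=
  forall x y : H, dot (f x) y = dot x (g y).

Definition positive_op (f : op) : Prop := forall x : H, 0 <= dot (f x) x.

Definition projection_op (p : op) : Prop :=
  [/\ bounded_op p, adjoint_op p p & p \o p = p].

Definition subalgebra (A : set op) : Prop :=
  [/\ A idfun,
      forall (a : R[i]) (x y : op), A x -> A y -> A (fun h => a *: x h + y h) &
      forall x y : op, A x -> A y -> A (x \o y)].

Definition algebra_gen (S : set op) : set op :=
  [set x | forall A : set op, subalgebra A -> S `<=` A -> A x].

Definition commutant (S : set op) : set op :=
  [set x | bounded_op x /\ forall y : op, S y -> x \o y = y \o x].

(* The closure of S in the bounded operators for the weak operator topology. *)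
Definition weak_closure (S : set op) : set op :=
  [set x | bounded_op x /\
    forall (s : seq (H * H)) (eps : R), 0 < eps ->
      exists2 y : op, S y &
        forall uv, uv \in s -> `|dot (x uv.1 - y uv.1) uv.2| < eps%:C%C].

Definition orbit_vec (S : set op) (h : H) : set H := [set x h | x in S].

(* P is the orthogonal projection onto the subspace V, where the operator P
   is only looked at on the subspace K. *)
Definition orth_proj_on (K V : set H) (P : op) : Prop :=
  forall h : H, K h -> V (P h) /\ forall v : H, V v -> dot (h - P h) v = 0.

Definition vec_trace (Om : H) (x : op) : R[i] := dot (x Om) Om.

(* (H, Om) is the GNS representation of the trace vec_trace Om on A: this
   determines (A, H, Om) up to unitary equivalence. *)
Definition gns_trace_vector (A : set op) (Om : H) : Prop :=
  [/\ `|Om| = 1,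
      forall x y : op, A x -> A y -> vec_trace Om (x \o y) = vec_trace Om (y \o x) &
      closure (orbit_vec A Om) = setT].

Definition linear_on (V : lmodType R[i]) (A : set op) (F : op -> V) : Prop :=
  forall (a : R[i]) (x y : op), A x -> A y ->
    F (fun h => a *: x h + y h) = a *: F x + F y.

Definition is_cond_exp (Om : H) (M N : set op) (E : op -> op) : Prop :=
  [/\ linear_on (M : set op) (E : op -> (H -> H)),
      forall x, M x -> N (E x) /\ vec_trace Om (E x) = vec_trace Om x,
      forall x, N x -> E x = x,
      forall a x b, N a -> M x -> N b -> E (a \o x \o b) = a \o E x \o b &
      forall x, M x -> positive_op x -> positive_op (E x)].

Definition Lambda (Om : H) (M N : set op) : set R :=
  [set alpha | 0 <= alpha <= 1 /\
    exists E : op -> op, is_cond_exp Om M N E /\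
    exists p : op, [/\ M p, projection_op p &
      E p = (fun h => alpha%:C%C *: h)]].

Definition tracial_state (A : set op) (tau : op -> R[i]) : Prop :=
  [/\ linear_on (A : set op) (tau : op -> (R[i])^o), tau idfun = 1,
      forall x y, A x -> A y -> tau (x \o y) = tau (y \o x) &
      forall x, A x -> positive_op x -> 0 <= tau x].

(* The Murray-von Neumann coupling constant dim_N(H) of a II_1 factor N with
   finite commutant N': it is tau(P) / tau'(Q), where tau and tau' are the
   (unique) normalized traces of N and N', and P, Q are the projections onto
   the closures of N' h and N h; the ratio is the same for every h <> 0. *)
Definition coupling_constant (N : set op) (c : R) : Prop :=
  exists tau tau' : op -> R[i],
    [/\ tracial_state N tau, tracial_state (commutant N) tau' &
      forall (h : H) (P Q : op), h != 0 ->
        bounded_op P -> bounded_op Q ->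
        orth_proj_on setT (closure (orbit_vec (commutant N) h)) P ->
        orth_proj_on setT (closure (orbit_vec N h)) Q ->
        tau P / tau' Q = c%:C%C].

(* [M : N] = dim_N(L^2(M)), the space H being L^2(M). *)
Definition jones_index (Om : H) (M N : set op) (c : R) : Prop :=
  gns_trace_vector M Om /\ coupling_constant N c.

(* L is the basic construction <Q, e> of P in Q. The isomorphism phi takes L
   to operators on L^2(Q) = Q Om, elements of Q to left multiplications and e
   to the projection onto L^2(P). The values of phi are only looked at on Q Om,
   which they map to itself. *)
Definition basic_construction (Om : H) (P Q : set op) (e : op) (L : set op)
    : Prop :=
  L = algebra_gen (Q `|` [set e]) /\
  let K := orbit_vec Q Om in
  exists phi : op -> op,
  [/\ forall x h, L x -> K h -> K (phi x h),
      forall a x y h, L x -> L y -> K h ->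
        phi (fun g => a *: x g + y g) h = a *: phi x h + phi y h /\
        phi (x \o y) h = phi x (phi y h),
      forall x y h k, L x -> L y -> adjoint_op x y -> K h -> K k ->
        dot (phi x h) k = dot h (phi y k),
      forall x, L x -> (forall h, K h -> phi x h = 0) -> x = (fun=> 0) &
      (forall x h, Q x -> K h -> phi x h = x h) /\
      orth_proj_on K (orbit_vec P Om) (phi e)].

Definition adjmx (m : nat) (X : 'M[R[i]]_m) : 'M[R[i]]_m :=
  map_mx (@Num.conj R[i]) X^T.

Definition star_embedding (m : nat) (pi : 'M[R[i]]_m -> op) : Prop :=
  [/\ forall X, bounded_op (pi X) /\ adjoint_op (pi X) (pi (adjmx X)),
      forall a X Y, pi (a *: X + Y) = (fun h => a *: pi X h + pi Y h),
      forall X Y, pi (X *m Y) = pi X \o pi Y,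
      pi 1%:M = idfun & injective pi].

(* The towers (A_k), (B_k) grown from the commuting square with corners
   A_0 = SA, A_1 = 'M_m, B_0 = C, B_1 = SB, realized on the GNS space of the
   Markov trace; e k is the Jones projection e_k, used for k >= 2. *)
Record square_tower (Om : H) (m : nat) (SA SB : set 'M[R[i]]_m)
    (A B : nat -> set op) (e : nat -> op) : Prop := SquareTower {
  tower_start : exists2 pi : 'M[R[i]]_m -> op, star_embedding pi &
    [/\ A 0%N = pi @` SA, A 1%N = range pi,
        B 0%N = [set (fun h => a *: h) | a in [set: R[i]]] & B 1%N = pi @` SB];
  tower_proj : forall k, projection_op (e k.+2);
  tower_A : forall k, basic_construction Om (A k) (A k.+1) (e k.+2) (A k.+2);
  tower_B : forall k, B k.+2 = algebra_gen (B k.+1 `|` [set e k.+2]);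
  tower_gns : gns_trace_vector (\bigcup_k A k) Om;
  tower_markov : exists lam : R[i], forall k x, A k.+1 x ->
    vec_trace Om (x \o e k.+2) = lam * vec_trace Om x }.

Definition square_subfactor (Om : H) (m : nat) (SA SB : set 'M[R[i]]_m)
    (M N : set op) : Prop :=
  exists (A B : nat -> set op) (e : nat -> op),
    [/\ square_tower Om SA SB A B e,
        M = weak_closure (\bigcup_k A k) & N = weak_closure (\bigcup_k B k)].

Definition unitary_mx (m : nat) (u : 'M[R[i]]_m) : Prop :=
  u *m adjmx u = 1%:M /\ adjmx u *m u = 1%:M.

Definition Ad (m : nat) (u X : 'M[R[i]]_m) : 'M[R[i]]_m := u *m X *m adjmx u.

Definition complex_hadamard (m : nat) (u : 'M[R[i]]_m) : Prop :=
  unitary_mx u /\ forall i j, `|u i j| = ((Num.sqrt (m%:R : R))^-1)%:C%C.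

Definition diagonal_mxs (m : nat) : set 'M[R[i]]_m := [set X | is_diag_mx X].

Definition spin_model_subfactor (Om : H) (M N : set op) : Prop :=
  exists (m : nat) (u : 'M[R[i]]_m), complex_hadamard u /\
    square_subfactor Om (@diagonal_mxs m) (Ad u @` @diagonal_mxs m) M N.

(* M_l (x) M_k is 'M_(l * k), with entry w_(al, a)^(be, b) in row
   mxtens_index (al, a) and column mxtens_index (be, b). *)
Definition block_transpose (l k : nat) (w : 'M[R[i]]_(l * k)) : 'M[R[i]]_(l * k) :=
  \matrix_(r, c)
    w (mxtens.mxtens_index ((mxtens.mxtens_unindex c).1, (mxtens.mxtens_unindex r).2))
      (mxtens.mxtens_index ((mxtens.mxtens_unindex r).1, (mxtens.mxtens_unindex c).2)).

Definition bi_unitary (l k : nat) (w : 'M[R[i]]_(l * k)) : Prop :=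
  unitary_mx w /\ unitary_mx (block_transpose w).

(* For l = 1 the square is degenerate: A_0 = A_1 and B_0 = B_1, and the
   resulting algebras are finite dimensional, not II_1 factors. *)
Definition vertex_model_subfactor (Om : H) (M N : set op) : Prop :=
  exists (l k : nat) (v : 'M[R[i]]_(l * k)), (1 < l)%N /\ bi_unitary v /\
    square_subfactor Om
      [set mxtens.tensmx (1%:M : 'M[R[i]]_l) Y | Y in [set: 'M[R[i]]_k]]
      (Ad v @` [set mxtens.tensmx X (1%:M : 'M[R[i]]_k) | X in [set: 'M[R[i]]_l]])
      M N.

End Operators.

Definition increasing_seq_to (R : realType) (L : set R) (t l : R) : Prop :=
  exists alpha : nat -> R,
    [/\ forall j, alpha j < alpha j.+1,
        forall j, L (alpha j) /\ t < alpha j < 1 - t &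
        alpha @ \oo --> l].

(* Main.v *)
Require Import Defs.
From HB Require Import structures.
From mathcomp Require Import all_boot all_order all_algebra.
From mathcomp Require Import all_classical all_reals all_analysis.
From mathcomp Require Import complex.
From mathcomp Require mxtens.
From mathcomp Require Import zify ring lra.

(** Write M and N for the weak closures of the unions of the A_k and the B_k.

    In both models A_0 and the B_k are independent for the trace,
    tau (f b) = tau f tau b for f in A_0, and A_k = A_0 B_k = B_k A_0. The first
    fact climbs the tower because B_(k+1) is spanned by B_k and B_k e B_k, where
    the Markov property computes the expectation (square_at_all, tau_mul); the
    second because the Jones projections commute with A_0 (A_expand). An
    orthonormal basis a_i of A_0 is therefore an orthonormal basis of M over N.
    With p the projection onto the closure of N Om and r_i the right
    multiplication by a_i, the projections r_i^* p r_i add up to 1. Two things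
    follow. The conditional expectation of M onto N is x |-> sum r_i^* p x p r_i
    (framed_cond_exp). And these projections are equivalent in the commutant of
    N, where p thus has trace 1 / dim A_0, so that the index is dim A_0
    (framed_coupling_constant): it is m for a spin model of size m, and k^2 for a
    vertex model on M_l (x) M_k.

    A_0 contains orthogonal projections g_1, ..., g_m of trace 1/m, where m = k
    for the vertex model. From the Jones projections and a basis of B_1, of D elements, one builds
    d = D^(K+1) elements W_I of some B_k such that x |-> sum W_I x_IJ W_J^* is a
    homomorphism from the d by d matrices over A_0 to A_k (matrix_frames). As
    the W_I lie in N, the expectation of the image of x is
    sum tau(x_IJ) W_I W_J^*. So if m projections P_s of the d by d matrices add
    up to the scalar beta, the image of sum P_s (x) g_s is a projection of
    M with expectation beta / m (projections_Lambda).

    It remains to find scalar sums of projections. Four projections of the d by d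
    matrices add up to 2 - 1/d (chain_projections, scalar_sum_projections): a sum
    of two projections is 1 + c where the spectrum of c is symmetric apart from
    the values 0 and -1, and for the chain c = 0, -2/d, 2/d, -4/d, 4/d, ... of d
    terms both c and -1/d - c consist of symmetric pairs and such values. Adding i
    copies of the identity gives beta = 2 + i - 1/d, for i up to m - 4, and
    letting K grow makes beta / m increase to (2 + i) / m. *)

Import Order.TTheory GRing.Theory Num.Theory.
Import numFieldNormedType.Exports.
Local Open Scope classical_set_scope.
Local Open Scope ring_scope.

Set Implicit Arguments.
Unset Strict Implicit.
Unset Printing Implicit Defensive.

(** * Inner products *)

Section HilbertSpace.
Context {R : realType} {H : completeNormedModType R[i]}.
Variable dot : {dot H for (@Num.conj R[i])}.

Lemma dotC u v : dot u v = (dot v u)^*.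
Proof. by rewrite hermC expr0 mul1r. Qed.

Lemma dotPl a u v w : dot (a *: u + v) w = a * dot u w + dot v w.
Proof. by rewrite linearDl linearZl_LR. Qed.

Lemma dotZl a u w : dot (a *: u) w = a * dot u w.
Proof. by rewrite linearZl_LR. Qed.

Lemma dotZr a u w : dot u (a *: w) = a^* * dot u w.
Proof. by rewrite linearZr_LR. Qed.

Lemma dotBl u v w : dot (u - v) w = dot u w - dot v w.
Proof. by rewrite linearBl. Qed.

Lemma dotBr u v w : dot u (v - w) = dot u v - dot u w.
Proof. by rewrite linearBr. Qed.

Lemma dot_suml I (r : seq I) (P : pred I) (F : I -> H) w :
  dot (\sum_(i <- r | P i) F i) w = \sum_(i <- r | P i) dot (F i) w.
Proof. by rewrite linear_sumlz. Qed.

Lemma dot_sumr I (r : seq I) (P : pred I) (F : I -> H) w :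
  dot w (\sum_(i <- r | P i) F i) = \sum_(i <- r | P i) dot w (F i).
Proof. by rewrite linear_sumr. Qed.

Lemma dot_ge0 u : 0 <= dot u u.
Proof.
have [->|u0] := eqVneq u 0; first by rewrite linear0r.
exact/ltW/neq0_dnorm_gt0.
Qed.

Lemma dot_eq0 u : dot u u = 0 -> u = 0.
Proof.
by move=> uu; apply/eqP; apply: contraT => /(@neq0_dnorm_gt0 _ _ _ dot); rewrite uu ltxx.
Qed.

Lemma dot_inj u v : (forall w, dot u w = dot v w) -> u = v.
Proof.
move=> uv; apply/eqP; rewrite -subr_eq0; apply/eqP/dot_eq0.
by rewrite dotBl uv subrr.
Qed.

Hypothesis Hdot : norm_of_dot dot.

Lemma cauchy_schwarz u v : `|dot u v| <= `|u| * `|v|.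
Proof.
have [->|v0] := eqVneq v 0; first by rewrite linear0r !normr0 mulr0.
have v2 : 0 < `|v| ^+ 2 by rewrite exprn_gt0// normr_gt0.
have := dot_ge0 (dot v v *: u - dot u v *: v).
rewrite dotBl !dotBr !(dotZl, dotZr) -!Hdot.
rewrite (dotC v u) -(dotC v u) (dotC v u).
rewrite (geC0_conj (ltW v2)).
set c := dot u v; set a := `|v| ^+ 2; set b := `|u| ^+ 2.
have -> : a * (a * b) - a * (c^* * c) - (c * (a * c^*) - c * (c^* * a)) =
   a * (a * b - `|c| ^+ 2).
  by rewrite normCK; ring.
rewrite pmulr_rge0// subr_ge0 => h.
rewrite -(@ler_pXn2r _ 2) ?nnegrE ?mulr_ge0// exprMn mulrC.
exact: h.
Qed.

End HilbertSpace.

(** * Bounded operators and their extension from dense subspaces *)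

Section BoundedOperators.
Context {R : realType} {H : completeNormedModType R[i]}.
Local Notation C := R[i].
Implicit Types (f g : op H) (h k : H).

Let pack_linear f (lf : linear f) : {linear H -> H}
  := HB.pack f (GRing.isLinear.Build _ _ _ _ _ lf).

Lemma lin0 f : linear f -> f 0 = 0.
Proof. by move=> lf; exact: (linear0 (pack_linear lf)). Qed.

Lemma linB f h k : linear f -> f (h - k) = f h - f k.
Proof. by move=> lf; exact: (linearB (pack_linear lf)). Qed.

Lemma linZ f a h : linear f -> f (a *: h) = a *: f h.
Proof. by move=> lf; have := lf a h 0; rewrite (lin0 lf) !addr0. Qed.

Lemma lin_sum f I (r : seq I) (P : pred I) (F : I -> H) : linear f ->
  f (\sum_(i <- r | P i) F i) = \sum_(i <- r | P i) f (F i).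
Proof. by move=> lf; exact: (linear_sum (pack_linear lf)). Qed.

Lemma bounded_opP f :
  bounded_op f <->
  linear f /\ exists2 c : C, 0 <= c & forall h, `|f h| <= c * `|h|.
Proof.
split=> [[lf cf]|[lf [c c0 fc]]]; split => //.
  have /linear_bounded_continuous/linear_boundedP : continuous (pack_linear lf) by [].
  move=> /pinfty_ex_gt0 [c c0 fc]; exists c => //; exact: ltW.
apply/(@linear_bounded_continuous _ _ _ (pack_linear lf))/linear_boundedP.
near=> r => x; apply: (le_trans (fc x)); rewrite ler_wpM2r//.
near: r; apply: nbhs_pinfty_ge; exact: ger0_real.
Unshelve. all: by end_near. Qed.

Lemma bounded_op_lin f : bounded_op f -> linear f.
Proof. by case. Qed.

Lemma bounded_op_id : bounded_op (idfun : op H).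
Proof.
apply/bounded_opP; split=> //; exists 1 => // h; by rewrite mul1r.
Qed.

Lemma bounded_op_comp f g : bounded_op f -> bounded_op g -> bounded_op (f \o g).
Proof.
move=> /bounded_opP[lf [c c0 fc]] /bounded_opP[lg [d d0 gd]].
apply/bounded_opP; split=> [a h k|] /=; first by rewrite lg lf.
exists (c * d); first exact: mulr_ge0.
by move=> h /=; rewrite (le_trans (fc _))// -mulrA ler_wpM2l.
Qed.

Lemma bounded_op_comb a f g : bounded_op f -> bounded_op g ->
  bounded_op (fun h => a *: f h + g h).
Proof.
move=> /bounded_opP[lf [c c0 fc]] /bounded_opP[lg [d d0 gd]].
apply/bounded_opP; split=> [b h k|] /=.
  by rewrite lg lf !scalerDr !scalerA mulrC addrACA.
exists (`|a| * c + d); first by rewrite addr_ge0// mulr_ge0.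
move=> h /=; rewrite (le_trans (ler_normD _ _))// mulrDl lerD//.
by rewrite normrZ -mulrA ler_wpM2l.
Qed.

Lemma bounded_op0 : bounded_op (fun=> 0 : H).
Proof.
apply/bounded_opP; split=> [a h k|]; first by rewrite scaler0 addr0.
by exists 0 => // h; rewrite normr0 mul0r.
Qed.

Lemma bounded_op_sum (I : Type) (r : seq I) (F : I -> op H) :
  (forall i, bounded_op (F i)) -> bounded_op (fun h => \sum_(i <- r) F i h).
Proof.
move=> bF; elim: r => [|i r IH].
  by under [X in bounded_op X]funext do rewrite big_nil; exact: bounded_op0.
have := bounded_op_comb 1 (bF i) IH; congr bounded_op.
by apply/funext => h; rewrite scale1r big_cons.
Qed.

Lemma closure_normP (V : set H) h :
  closure V h <-> forall eps : C, 0 < eps -> exists2 d, V d & `|h - d| < eps.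
Proof.
split=> [cV eps e0|cV B /nbhs_ballP[e /= e0 eB]].
  have [] := cV (ball h eps); first exact: nbhsx_ballx.
  by move=> d [Vd]; rewrite -ball_normE /= => hd; exists d.
have [d Vd hd] := cV e e0; exists d; split=> //; apply: eB.
by rewrite -ball_normE.
Qed.

Lemma norm_small0 h : (forall eps : C, 0 < eps -> `|h| <= eps) -> h = 0.
Proof.
move=> hs; apply/eqP; rewrite -normr_eq0 eq_le normr_ge0 andbT.
by apply/ler_addgt0Pr => e e0; rewrite add0r hs.
Qed.

(** A bounded relation with dense domain has Cauchy values along any net in
    the domain, so completeness extends it; the estimate against the graph
    itself then gives linearity and the bound at once. *)
Lemma bounded_graph_extension (G : H -> H -> Prop) (c : C) : 0 <= c ->
  (forall a h k h' k', G h k -> G h' k' -> G (a *: h + h') (a *: k + k')) ->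
  (forall h k, G h k -> `|k| <= c * `|h|) ->
  closure [set h | exists k, G h k] = setT ->
  exists2 T : op H, bounded_op T & forall h k, G h k -> T h = k.
Proof.
move=> c0 Glin Gc Gd.
have Gdiff h k h' k' : G h k -> G h' k' -> `|k - k'| <= c * `|h - h'|.
  move=> hk hk'; have := Gc _ _ (Glin (-1) _ _ _ _ hk' hk).
  by rewrite !scaleN1r addrC [- h' + h]addrC.
have dns h (e : C) : 0 < e -> exists d k, G d k /\ `|h - d| < e.
  move=> e0; have /closure_normP/(_ e e0)[d [k dk] hd] :
    closure [set h | exists k, G h k] h by rewrite Gd.
  by exists d, k.
have ext h : exists y, forall d k, G d k -> `|k - y| <= c * `|d - h|.
  (* the values of G near h generate a Cauchy filter, whose limit is T h *)
  pose S (e : C) := [set k | exists2 d, G d k & `|h - d| < e].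
  pose F := filter_from [set e : C | 0 < e] S.
  have FF : ProperFilter F.
    apply: filter_from_proper; last first.
      by move=> e /= /(dns h)[d [k [dk hd]]]; exists k, d.
    apply: filter_from_filter; first by exists 1 => /=.
    move=> e e' /= e0 e'0.
    have e'r := gtr0_real e'0; have er := gtr0_real e0.
    exists (Order.min e e'); first by rewrite /= comparable_lt_min ?e0//; exact: real_comparable.
    by move=> k [d dk]; rewrite comparable_lt_min ?real_comparable// => /andP[d1 d2]; split; exists d.
  have : cauchy F.
    apply: cauchy_exP => eps e0.
    pose e := eps / (2 * (c + 1)).
    have c1 : 0 < c + 1 by rewrite ltr_wpDl.
    have ep : 0 < e by rewrite divr_gt0// mulr_gt0.
    have [d [k [dk hd]]] := dns h e ep.
    exists k; exists e => // k' [d' dk' hd']; rewrite -ball_normE /=.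
    apply: (le_lt_trans (Gdiff _ _ _ _ dk dk')).
    apply: (@le_lt_trans _ _ (c * (e + e))).
      rewrite ler_wpM2l// -(subrKA h) (le_trans (ler_normD _ _))// lerD//.
        by rewrite distrC ltW.
      exact: ltW.
    have -> : e + e = eps / (c + 1).
      by rewrite /e; field; rewrite (lt0r_neq0 c1).
    by rewrite mulrCA gtr_pMr// ltr_pdivrMr// mul1r ltrDl.
  move=> /cauchy_cvg/cvg_ex[y Fy]; exists y => d k dk.
  apply/ler_addgt0Pr => e e0.
  have c1 : 0 < c + 1 by rewrite ltr_wpDl.
  have e1 : 0 < e / (2 * (c + 1)) by rewrite divr_gt0// mulr_gt0.
  have : F (ball y (e / 2)) by apply: Fy; apply: nbhsx_ballx; rewrite divr_gt0.
  case=> e' /= e'0 Se'.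
  have e'r := gtr0_real e'0; have er := gtr0_real e1.
  have [|d' [k' [dk' hd']]] := dns h (Order.min e' (e / (2 * (c + 1)))).
    by rewrite comparable_lt_min ?real_comparable// e'0.
  move: hd'; rewrite comparable_lt_min ?real_comparable// => /andP[h1 h2].
  have : S e' k' by exists d'.
  move=> /Se'; rewrite -ball_normE /= => yk'.
  rewrite -(subrKA k') (le_trans (ler_normD _ _))//.
  apply: (@le_trans _ _ (c * (`|d - h| + e / (2 * (c + 1))) + e / 2)).
    apply: lerD; last by rewrite distrC ltW.
    rewrite (le_trans (Gdiff _ _ _ _ dk dk'))// ler_wpM2l//.
    by rewrite -(subrKA h) (le_trans (ler_normD _ _))// lerD// ltW.
  rewrite mulrDr -addrA lerD2l.
  rewrite [leRHS]splitr lerD2r.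
  have -> : c * (e / (2 * (c + 1))) = (c / (c + 1)) * (e / 2).
    by field; rewrite (lt0r_neq0 c1).
  rewrite ler_piMl// ?ltW ?divr_gt0// ltr_pdivrMr// mul1r.
  by rewrite ltrDl.
have [T TP] := choice ext.
have small h k : (forall e : C, 0 < e -> `|h - k| <= e) -> h = k.
  by move=> hk; apply/eqP; rewrite -subr_eq0; apply/eqP/norm_small0.
have TG h k : G h k -> T h = k.
  move=> hk; apply/esym/eqP; rewrite -subr_eq0 -normr_eq0 eq_le normr_ge0 andbT.
  by have := TP h _ _ hk; rewrite subrr normr0 mulr0.
exists T => //; apply/bounded_opP; split; last first.
  exists c => // h; have [d [k [dk _]]] := dns 0 1 ltr01.
  have G00 : G 0 0.
    by have := Glin (-1) _ _ _ _ dk dk; rewrite !scaleN1r !addNr.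
  by have := TP h _ _ G00; rewrite !sub0r !normrN.
move=> a h k; apply: small => e e0.
pose M : C := c * (`|a| + 1) *+ 2 + 1.
have M0 : 0 < M by rewrite ltr_wpDl// mulrn_wge0// mulr_ge0// addr_ge0.
have eM : 0 < e / M by rewrite divr_gt0.
have [d [u [du hd]]] := dns h _ eM.
have [d' [u' [du' hd']]] := dns k _ eM.
rewrite -(subrKA (a *: u + u')) (le_trans (ler_normD _ _))//.
have t : `|d - h| * `|a| + `|d' - k| <= (e / M) * (`|a| + 1).
  by rewrite mulrDr mulr1 lerD// ?ler_wpM2r// distrC ltW.
apply: (@le_trans _ _ (c * ((e / M) * (`|a| + 1)) + c * ((e / M) * (`|a| + 1)))).
  apply: lerD.
    rewrite distrC (le_trans (TP _ _ _ (Glin a _ _ _ _ du du')))// ler_wpM2l//.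
    rewrite opprD addrACA -scalerBr (le_trans (ler_normD _ _))//.
    by rewrite normrZ mulrC.
  rewrite opprD addrACA -scalerBr (le_trans (ler_normD _ _))// normrZ.
  apply: (@le_trans _ _ (`|a| * (c * `|d - h|) + c * `|d' - k|)).
    by rewrite lerD// ?ler_wpM2l// TP.
  by rewrite mulrCA -mulrDr ler_wpM2l// mulrC.
have sumE (X Y : C) (Y0 : Y != 0) :
  c * (e / Y * X) + c * (e / Y * X) = e * ((c * X *+ 2) / Y) by field.
rewrite sumE ?lt0r_neq0//.
have -> : c * (`|a| + 1) *+ 2 = M - 1 by rewrite addrK.
rewrite ler_piMr// ?ltW// ltr_pdivrMr// mul1r.
by rewrite ltrBlDr ltrDl.
Unshelve. all: by end_near. Qed.

End BoundedOperators.

(** * Adjoints and weak closures *)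

Section Adjoints.
Context {R : realType} {H : completeNormedModType R[i]}.
Variable dot : {dot H for (@Num.conj R[i])}.
Local Notation C := R[i].
Implicit Types (f g : op H) (h k : H).

Lemma adjoint_lin f g : adjoint_op dot f g -> linear f.
Proof.
move=> fg a h k; apply: (dot_inj (dot := dot)) => w.
by rewrite fg !dotPl !fg.
Qed.

Lemma adjoint_sym f g : adjoint_op dot f g -> adjoint_op dot g f.
Proof. by move=> fg h k; rewrite dotC -fg -dotC. Qed.

Lemma adjoint_comp f g f' g' : adjoint_op dot f g -> adjoint_op dot f' g' ->
  adjoint_op dot (f \o f') (g' \o g).
Proof. by move=> fg fg' h k /=; rewrite fg fg'. Qed.

Lemma adjoint_comb a f g f' g' : adjoint_op dot f g -> adjoint_op dot f' g' ->
  adjoint_op dot (fun h => a *: f h + f' h) (fun h => a^* *: g h + g' h).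
Proof.
move=> fg fg' h k /=; rewrite dotPl fg fg' [RHS]linearDr linearZr_LR /=.
by rewrite conjCK.
Qed.

Lemma adjoint_id : adjoint_op dot (idfun : op H) idfun.
Proof. by []. Qed.

Lemma adjoint_scal a : adjoint_op dot (fun h => a *: h) (fun h => a^* *: h).
Proof. by move=> h k /=; rewrite dotZl dotZr conjCK. Qed.

Lemma adjoint0 : adjoint_op dot (fun=> 0 : H) (fun=> 0 : H).
Proof. by move=> h k /=; rewrite linear0l linear0r. Qed.

Lemma adjoint_sum (I : Type) (r : seq I) (F G : I -> op H) :
  (forall i, adjoint_op dot (F i) (G i)) ->
  adjoint_op dot (fun h => \sum_(i <- r) F i h) (fun h => \sum_(i <- r) G i h).
Proof.
by move=> FG h k; rewrite dot_suml dot_sumr; apply: eq_bigr => i _; rewrite FG.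
Qed.

Hypothesis Hdot : norm_of_dot dot.

Lemma dense_vanish (phi : H -> C) (V : set H) (c : C) : closure V = setT ->
  0 <= c -> (forall h v, V v -> `|phi h - phi v| <= c * `|h - v|) ->
  (forall v, V v -> phi v = 0) -> forall h, phi h = 0.
Proof.
move=> dV c0 phic phi0 h; apply/eqP.
rewrite -normr_eq0 eq_le normr_ge0 andbT.
apply/ler_addgt0Pr => e e0; rewrite add0r.
have c1 : 0 < c + 1 by rewrite ltr_wpDl.
have : closure V h by rewrite dV.
move/closure_normP => /(_ (e / (c + 1))) [|v Vv hv]; first by rewrite divr_gt0.
have := phic h v Vv; rewrite (phi0 _ Vv) subr0 => /le_trans; apply.
apply: (@le_trans _ _ (c * (e / (c + 1)))); first by rewrite ler_wpM2l// ltW.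
by rewrite mulrCA ler_piMr ?ltW// ltr_pdivrMr// mul1r ltrDl.
Qed.

Lemma dense_orth (V : set H) h : closure V = setT ->
  (forall v, V v -> dot h v = 0) -> h = 0.
Proof.
move=> dV hV; apply: (dot_eq0 (dot := dot)).
apply: (dense_vanish (phi := dot h) (c := `|h|) dV) => //.
by move=> k v _; rewrite -dotBr cauchy_schwarz.
Qed.

(** An everywhere defined adjoint replaces continuity in density arguments. *)
Lemma dense_adjoint_eq (V : set H) f f' g g' : closure V = setT ->
  adjoint_op dot f f' -> adjoint_op dot g g' -> (forall v, V v -> f v = g v) ->
  f = g.
Proof.
move=> dV ff' gg' fg.
have fg' : f' = g'.
  apply/funext => k; apply/eqP; rewrite -subr_eq0; apply/eqP.
  apply: (dense_orth dV) => v Vv; rewrite dotC dotBr -ff' -gg' fg//.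
  by rewrite subrr conjC0.
apply/funext => h; apply: (dot_inj (dot := dot)) => w.
by rewrite ff' gg' fg'.
Qed.

Lemma dense_adjoint (V : set H) f g : closure V = setT ->
  bounded_op f -> bounded_op g ->
  (forall u v, V u -> V v -> dot (f u) v = dot u (g v)) -> adjoint_op dot f g.
Proof.
move=> dV /bounded_opP[lf [c c0 fc]] /bounded_opP[lg [d d0 gd]] fg h k.
apply/eqP; rewrite -subr_eq0; apply/eqP.
apply: (dense_vanish (phi := fun h => dot (f h) k - dot h (g k))
  (c := c * `|k| + `|g k|) dV) => [|{}h v _|v Vv].
- by rewrite addr_ge0// mulr_ge0.
- have -> : dot (f h) k - dot h (g k) - (dot (f v) k - dot v (g k)) =
      dot (f (h - v)) k - dot (h - v) (g k) by rewrite linB// !dotBl; ring.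
  rewrite (le_trans (ler_normD _ _))// normrN mulrDl lerD//.
    by rewrite (le_trans (cauchy_schwarz Hdot _ _))// mulrAC ler_wpM2r.
  by rewrite (le_trans (cauchy_schwarz Hdot _ _))// mulrC distrC.
apply: (dense_vanish (phi := fun k => dot (f v) k - dot v (g k))
  (c := `|f v| + `|v| * d) dV) => [|h' w _|w Vw].
- by rewrite addr_ge0// mulr_ge0.
- have -> : dot (f v) h' - dot v (g h') - (dot (f v) w - dot v (g w)) =
      dot (f v) (h' - w) - dot v (g (h' - w)) by rewrite linB// !dotBr; ring.
  rewrite (le_trans (ler_normD _ _))// normrN mulrDl lerD//.
    exact: cauchy_schwarz.
  rewrite (le_trans (cauchy_schwarz Hdot _ _))// -mulrA ler_wpM2l//.
by rewrite fg// subrr.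
Qed.

Lemma sub_weak_closure (S : set (op H)) x :
  S x -> bounded_op x -> weak_closure dot S x.
Proof.
move=> Sx bx; split=> // s eps e0; exists x => // uv _.
by rewrite subrr linear0l normr0 ltcR.
Qed.

Lemma weak_closure_mono (S S' : set (op H)) :
  S `<=` S' -> weak_closure dot S `<=` weak_closure dot S'.
Proof.
move=> SS' x [bx wx]; split=> // s eps e0.
by have [y Sy yP] := wx s eps e0; exists y => //; exact: SS'.
Qed.

Lemma real_small0 (z : C) : (forall e : R, 0 < e -> `|z| <= e%:C%C) -> z = 0.
Proof.
move=> zs; apply/eqP; rewrite -normr_eq0 eq_le normr_ge0 andbT.
have zr : `|z| = (complex.Re `|z|)%:C%C by rewrite RRe_real// normr_real.
rewrite zr lecR; apply/ler_addgt0Pr => e e0.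
by rewrite add0r -lecR -zr zs.
Qed.

(** The adjoint of T turns <T x h, k> into a matrix coefficient of x, so both
    sides of T x = x T are weakly continuous in x. *)
Lemma weak_closure_commute (S : set (op H)) T T' x :
  adjoint_op dot T T' -> (forall y, S y -> T \o y = y \o T) ->
  weak_closure dot S x -> T \o x = x \o T.
Proof.
move=> TT' cT [bx wx]; apply/funext => h /=.
apply: (dot_inj (dot := dot)) => k; apply/eqP; rewrite -subr_eq0; apply/eqP.
apply: real_small0 => e e0.
have [|y Sy yP] := wx [:: (h, T' k); (T h, k)] (e / 2); first by rewrite divr_gt0.
have y1 := yP (h, T' k) (mem_head _ _).
have y2 : `|dot (x (T h) - y (T h)) k| < (e / 2)%:C%C.
  by apply: (yP (T h, k)); rewrite !inE eqxx orbT.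
have -> : dot (T (x h)) k - dot (x (T h)) k =
    dot (x h - y h) (T' k) - dot (x (T h) - y (T h)) k.
  rewrite !dotBl TT'; have := congr1 (fun z => z h) (cT y Sy) => /= <-.
  by rewrite TT'; ring.
rewrite (le_trans (ler_normB _ _))// [e]splitr rmorphD /= lerD// ltW//.
Qed.

(** A matrix coefficient of sum_i T_i^* x T_i at (u, v) is a sum of matrix
    coefficients of x at (T_i u, T_i v), so such compressions pass to the weak
    closure from any set on which they are controlled. *)
Lemma weak_closure_compress (I : finType) (V T : I -> op H) (S S' : set (op H)) x :
  (forall i, adjoint_op dot (V i) (T i)) ->
  (forall i, bounded_op (V i)) -> (forall i, bounded_op (T i)) ->
  (forall y, S y -> S' (fun h => \sum_i V i (y (T i h)))) ->
  weak_closure dot S x -> weak_closure dot S' (fun h => \sum_i V i (x (T i h))).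
Proof.
move=> VT bV bT SS' [bx wx]; split.
  apply: bounded_op_sum => i.
  exact: (bounded_op_comp (bV i) (bounded_op_comp bx (bT i))).
move=> s eps e0.
pose s' := [seq (T i uv.1, T i uv.2) | uv <- s, i <- enum I].
pose n : R := #|I|%:R + 1.
have n0 : 0 < n by rewrite ltr_wpDl.
have [|y Sy yP] := wx s' (eps / n); first by rewrite divr_gt0.
exists (fun h => \sum_i V i (y (T i h))); first exact: SS'.
move=> uv uvs; rewrite -sumrB dot_suml.
rewrite (le_lt_trans (ler_norm_sum _ _ _))//.
apply: (@le_lt_trans _ _ (\sum_(i : I) (eps / n)%:C%C)).
  apply: ler_sum => i _; rewrite -linB; last exact/(adjoint_lin (VT i)).
  rewrite VT; apply: ltW; apply: (yP (T i uv.1, T i uv.2)).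
  by apply/allpairsP; exists (uv, i); split=> //=; rewrite mem_enum.
rewrite sumr_const -rmorphMn ltcR -mulr_natr -mulrA gtr_pMr//.
by rewrite mulrC ltr_pdivrMr// mul1r ltrDl.
Qed.

End Adjoints.

(** * Algebras of operators *)

Section Subalgebras.
Context {R : realType} {H : completeNormedModType R[i]}.
Variable dot : {dot H for (@Num.conj R[i])}.
Local Notation C := R[i].
Implicit Types (A S : set (op H)) (x y : op H).

Lemma subalgebra0 A : subalgebra A -> A (fun=> 0).
Proof.
move=> [A1 Al _]; have := Al (-1) _ _ A1 A1; congr A; apply/funext => h /=.
by rewrite scaleN1r addNr.
Qed.

Lemma subalgebraZ A a x : subalgebra A -> A x -> A (fun h => a *: x h).
Proof.
move=> sA Ax; have [_ Al _] := sA.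
have := Al a _ _ Ax (subalgebra0 sA); congr A; apply/funext => h /=.
by rewrite addr0.
Qed.

Lemma subalgebra_scal A a : subalgebra A -> A (fun h => a *: h).
Proof. by move=> sA; apply: (subalgebraZ a sA); case: sA. Qed.

Lemma subalgebraB A x y : subalgebra A -> A x -> A y -> A (fun h => x h - y h).
Proof.
move=> sA Ax Ay; have [_ Al _] := sA.
have := Al (-1) _ _ Ay Ax; congr A; apply/funext => h /=.
by rewrite scaleN1r addrC.
Qed.

Lemma subalgebra_sum A (I : Type) (r : seq I) (F : I -> op H) :
  subalgebra A -> (forall i, A (F i)) -> A (fun h => \sum_(i <- r) F i h).
Proof.
move=> sA AF; have [_ Al _] := sA; elim: r => [|i r IH].
  have := subalgebra0 sA; congr A.
  by apply/funext => h; rewrite big_nil.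
have := Al 1 _ _ (AF i) IH; congr A; apply/funext => h /=.
by rewrite big_cons scale1r.
Qed.

Lemma subalgebra_comp A x y : subalgebra A -> A x -> A y -> A (x \o y).
Proof. by move=> [_ _ Ac]; exact: Ac. Qed.

Lemma subalgebra_gen S : subalgebra (algebra_gen S).
Proof.
split=> [A [] //|a x y gx gy A sA SA|x y gx gy A sA SA].
- by have [_ Al _] := sA; apply: Al; [exact: gx|exact: gy].
- by have [_ _ Ac] := sA; apply: Ac; [exact: gx|exact: gy].
Qed.

Lemma sub_algebra_gen S : S `<=` algebra_gen S.
Proof. by move=> x Sx A _; apply. Qed.

Lemma algebra_gen_mono S S' : S `<=` S' -> algebra_gen S `<=` algebra_gen S'.
Proof. by move=> SS' x gx A sA S'A; apply: gx => // y /SS'/S'A. Qed.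

Definition star_closed A :=
  forall x, A x -> bounded_op x /\ exists2 y, A y & adjoint_op dot x y.

Lemma star_closed_gen S : star_closed S -> star_closed (algebra_gen S).
Proof.
move=> sS x; set P := fun x : op H => bounded_op x /\ exists2 y, algebra_gen S y & adjoint_op dot x y.
move=> gx; apply: (gx P); last first.
  move=> y /sS[by_ [z Sz yz]]; split=> //; exists z => //; exact: sub_algebra_gen.
have [g1 gl gc] := subalgebra_gen S.
split.
- by split; [exact: bounded_op_id|exists idfun => //; exact: adjoint_id].
- move=> a {gx}x y [bx [x' gx' xx']] [by_ [y' gy' yy']]; split.
    exact: bounded_op_comb.
  exists (fun h => a^* *: x' h + y' h); first exact: gl.
  exact: adjoint_comb.
- move=> {gx}x y [bx [x' gx' xx']] [by_ [y' gy' yy']]; split.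
    exact: bounded_op_comp.
  exists (y' \o x'); first exact: gc.
  exact: adjoint_comp.
Qed.

End Subalgebras.

(** * The trace of a matrix algebra *)

Section NormalizedTrace.
Context {R : realType} (r : nat).
Local Notation C := R[i].

Definition ntr (X : 'M[C]_r) : C := \tr X / r%:R.

Lemma ntrC X Y : ntr (X *m Y) = ntr (Y *m X).
Proof. by rewrite /ntr mxtrace_mulC. Qed.

Lemma ntrZ a X : ntr (a *: X) = a * ntr X.
Proof. by rewrite /ntr mxtraceZ mulrA. Qed.

End NormalizedTrace.

(** The matrix units e_ij are commutators for i <> j, and the e_ii are all
    conjugate, so a normalized trace has no freedom left. *)
Lemma trace_unique {R : realType} (r : nat) (F : 'M[R[i]]_r -> R[i]) :
  (forall a X Y, F (a *: X + Y) = a * F X + F Y) ->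
  (forall X Y, F (X *m Y) = F (Y *m X)) -> F 1%:M = 1 ->
  forall X, F X = ntr X.
Proof.
move=> Flin Ftr F1 X.
have F0 : F 0 = 0.
  have := Flin 1 0 0; rewrite scaler0 addr0 mul1r => /eqP.
  by rewrite -subr_eq0 opprD addNKr oppr_eq0 => /eqP.
have FZ a Y : F (a *: Y) = a * F Y.
  by have := Flin a Y 0; rewrite addr0 F0 addr0.
have FD Y Z : F (Y + Z) = F Y + F Z.
  by have := Flin 1 Y Z; rewrite scale1r mul1r.
have Fsum (I : finType) (P : pred I) (G : I -> 'M[R[i]]_r) :
    F (\sum_(i | P i) G i) = \sum_(i | P i) F (G i).
  by rewrite (big_morph F FD F0).
have Foff i j : F (delta_mx i j) = (i == j)%:R * F (delta_mx i i).
  have [<-|ij] := eqVneq i j; first by rewrite mul1r.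
  rewrite -{1}(mul_delta_mx i i j) Ftr mul_delta_mx_0 ?F0 ?mul0r//.
  by rewrite eq_sym.
have Fdiag i j : F (delta_mx i i) = F (delta_mx j j).
  by rewrite -(mul_delta_mx j i i) Ftr mul_delta_mx.
case: r F X Flin Ftr F1 F0 FZ FD Fsum Foff Fdiag => [|n] F' X _ _ F1 F0 FZ FD Fsum Foff Fdiag.
  have e : (1%:M : 'M[R[i]]_0) = 0 by apply/matrixP => -[].
  by move: F1; rewrite e F0 => /esym/eqP; rewrite oner_eq0.
have tr0 (Y : 'M[R[i]]_n.+1) : F' Y = \tr Y * F' (delta_mx 0 0).
  rewrite {1}(matrix_sum_delta Y) Fsum /mxtrace mulr_suml; apply: eq_bigr => i _.
  rewrite Fsum (bigD1 i)//= big1 ?addr0 => [|j ji].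
    by rewrite FZ (Fdiag i 0).
  by rewrite FZ Foff eq_sym (negbTE ji) mul0r mulr0.
move: F1; rewrite tr0 mxtrace1 => F1.
rewrite tr0 /ntr; congr (_ * _).
by apply: (@mulfI _ n.+1%:R); rewrite ?pnatr_eq0// F1 divff// pnatr_eq0.
Qed.

(** * The basic construction *)

Section BasicConstruction.
Context {R : realType} {H : completeNormedModType R[i]}.
Variable dot : {dot H for (@Num.conj R[i])}.
Local Notation C := R[i].
Variables (Om : H) (P Q L : set (op H)) (e : op H).
Hypotheses (subP : subalgebra P) (subQ : subalgebra Q) (PQ : P `<=` Q).
Hypothesis starP : star_closed dot P.
Hypothesis trQ : forall x y, Q x -> Q y ->
  vec_trace dot Om (x \o y) = vec_trace dot Om (y \o x).
Hypothesis bc : basic_construction dot Om P Q e L.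

(** y is the value at x of the trace-preserving conditional expectation onto P,
    seen through its vector y Om, the orthogonal projection of x Om. *)
Definition expects (P : set (op H)) (x y : op H) : Prop :=
  P y /\ forall c, P c -> dot (x Om) (c Om) = dot (y Om) (c Om).

Lemma bc_subalgebra : subalgebra L.
Proof. by have [-> _] := bc; exact: subalgebra_gen. Qed.

Lemma bc_subQ : Q `<=` L.
Proof. by have [-> _] := bc; move=> x Qx; apply: sub_algebra_gen; left. Qed.

Lemma bc_e : L e.
Proof. by have [-> _] := bc; apply: sub_algebra_gen; right. Qed.

Lemma orbit_expects (x y y' : op H) : Q x -> expects P x y -> expects P x y' ->
  y Om = y' Om.
Proof.
move=> Qx [Py xy] [Py' xy'].
apply/eqP; rewrite -subr_eq0; apply/eqP/(dot_eq0 (dot := dot)).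
have /= := subalgebraB subP Py Py' => Pd.
by rewrite dotBl -(xy _ Pd) -(xy' _ Pd) subrr.
Qed.

(** Everything used about the representation phi on L^2(Q): it is faithful
    for the values phi x (q Om), and phi e is the expectation onto P. *)
Lemma bc_repr : exists phi : op H -> op H,
  [/\ forall x q, Q x -> Q q -> phi x (q Om) = x (q Om),
      forall x y q, L x -> L y -> Q q ->
        phi (x \o y) (q Om) = phi x (phi y (q Om)),
      forall x y, L x -> L y ->
        (forall q, Q q -> phi x (q Om) = phi y (q Om)) -> x = y,
      (forall q y, Q q -> expects P q y -> phi e (q Om) = y Om) &
      forall q, Q q -> exists2 y, expects P q y & phi e (q Om) = y Om].
Proof.
have sL := bc_subalgebra; have [_ Llin _] := sL.
have [_ /= [phi [phiK philin phiadj phi0 [phiQ phie]]]] := bc.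
have ex q : Q q -> exists2 y, expects P q y & phi e (q Om) = y Om.
  move=> Qq; have [|[y Py yE] orth] := phie (q Om); first by exists q.
  exists y => //; split=> // c Pc; apply/eqP; rewrite -subr_eq0 -dotBl yE.
  by apply/eqP/orth; exists c.
exists phi; split=> //.
- by move=> x q Qx Qq; apply: phiQ => //; exists q.
- by move=> x y q Lx Ly Qq; apply: (philin 0 x y _ Lx Ly _).2; exists q.
- move=> x y Lx Ly xy.
  suff xy0 : (fun g => -1 *: y g + x g) = (fun=> 0).
    apply/funext => g; have /= := congr1 (fun f => f g) xy0.
    by rewrite scaleN1r addrC => /eqP; rewrite subr_eq0 => /eqP.
  apply: phi0; first exact: Llin.
  move=> _ [q Qq <-]; rewrite (philin (-1) y x _ Ly Lx _).1; last by exists q.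
  by rewrite xy// scaleN1r addNr.
- move=> q y Qq qy; have [y' qy' ->] := ex q Qq.
  by apply: orbit_expects qy' qy.
Qed.

Lemma expects_mull x y z : Q x -> P z -> expects P x y -> expects P (z \o x) (z \o y).
Proof.
move=> Qx Pz [Py xy]; split; first exact: subalgebra_comp.
move=> c Pc; have [_ [z' Pz' zz']] := starP Pz; rewrite /= !zz'.
by rewrite -[z' (c Om)]/((z' \o c) Om) xy//; exact: subalgebra_comp.
Qed.

Lemma expects_mulr x y z : Q x -> P z -> expects P x y -> expects P (x \o z) (y \o z).
Proof.
move=> Qx Pz [Py xy]; split; first exact: subalgebra_comp.
move=> c Pc; have [_ [z' Pz' zz']] := starP Pz.
have [_ [c' Pc' cc']] := starP Pc.
have Pcz : P (c \o z') by exact: subalgebra_comp.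
have mv w : Q w -> dot (w (z Om)) (c Om) = dot (w Om) ((c \o z') Om).
  move=> Qw; rewrite /= -!(adjoint_sym cc') -zz'.
  have := trQ (x := c' \o w) (y := z).
  rewrite /vec_trace/= => ->//; last exact: PQ.
  by apply: subalgebra_comp => //; exact: PQ.
by rewrite /= !mv//; [exact: xy|exact: PQ].
Qed.

Lemma bc_comm y : P y -> e \o y = y \o e.
Proof.
move=> Py; have [phi [phiQ phiM inj eq ex]] := bc_repr.
have Le := bc_e; have Qy := PQ Py; have Ly := bc_subQ Qy.
have sL := bc_subalgebra.
apply: inj => [||q Qq]; [exact: subalgebra_comp..|].
rewrite phiM// [RHS]phiM// phiQ//; have [z qz ->] := ex q Qq.
rewrite phiQ//; last by apply: PQ; case: qz.
rewrite -[y (q Om)]/((y \o q) Om) (eq _ (y \o z))//.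
  exact: subalgebra_comp.
exact: expects_mull.
Qed.

(** The Jones relation e x e = E(x) e. *)
Lemma bc_compress x y : Q x -> expects P x y -> e \o x \o e = y \o e.
Proof.
move=> Qx xy; have [phi [phiQ phiM inj eq ex]] := bc_repr.
have Le := bc_e; have Py := xy.1; have Qy := PQ Py; have Ly := bc_subQ Qy.
have Lx := bc_subQ Qx.
have sL := bc_subalgebra; have Lex : L (e \o x) by exact: subalgebra_comp.
apply: inj => [||q Qq]; [exact: subalgebra_comp..|].
rewrite phiM// [RHS]phiM//; have [z qz qE] := ex q Qq; have Pz := qz.1.
have Qz := PQ Pz.
rewrite qE phiM// !phiQ// -[x (z Om)]/((x \o z) Om) (eq _ (y \o z))//.
  exact: subalgebra_comp.
exact: expects_mulr.
Qed.

Lemma bc_fix_vacuum : forall phi : op H -> op H,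
  (forall q y, Q q -> expects P q y -> phi e (q Om) = y Om) -> phi e Om = Om.
Proof.
move=> phi eq; have [P1 _ _] := subP.
by rewrite -{1}[Om]/(idfun Om) (eq _ idfun)//; exact: PQ.
Qed.

(** Om is fixed by e in L^2(Q), so Q e Om is all of Q Om. *)
Lemma bc_zero z : L z -> (forall x, Q x -> z \o x \o e = (fun=> 0)) -> z = (fun=> 0).
Proof.
move=> Lz zx; have [phi [phiQ phiM inj eq ex]] := bc_repr.
have Le := bc_e; have sL := bc_subalgebra; have L0 := subalgebra0 sL.
have [Q1 _ _] := subQ.
apply: inj => // q Qq.
have phi0 h' : Q h' -> phi (fun=> 0) (h' Om) = 0.
  move=> Qh'; rewrite phiQ//; exact: subalgebra0.
have Lq := bc_subQ Qq.
have := congr1 (fun f => phi f (idfun Om)) (zx q Qq).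
rewrite phi0// phiM//; last exact: subalgebra_comp.
rewrite /= (bc_fix_vacuum eq) -[Om in phi _ Om]/(idfun Om) phiM//.
by rewrite phiQ//= => ->; rewrite phi0.
Qed.

Lemma bc_e_neq0 : Om != 0 -> e <> (fun=> 0).
Proof.
move=> Om0 e0; have [phi [phiQ phiM inj eq ex]] := bc_repr.
have [Q1 _ _] := subQ.
have := bc_fix_vacuum eq; rewrite e0 -{1}[Om]/(idfun Om) phiQ//=.
  by move=> /esym/eqP; rewrite (negbTE Om0).
exact: subalgebra0.
Qed.

End BasicConstruction.

(** * Towers over a commuting square *)

(** The tower without its matrix model: a and q are bases of A_0 and B_1,
    orthonormal for the trace, and a' and q' are their adjoints. The field
    ft_square is the commuting square condition at the bottom of the tower and
    ft_nondeg is its nondegeneracy, A_1 = A_0 B_1; the spin and vertex models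
    differ only in the size of these bases. *)
Record framed_tower {R : realType} {H : completeNormedModType R[i]}
    (dot : {dot H for (@Num.conj R[i])}) (Om : H) (I J : finType)
    (a a' : I -> op H) (q q' : J -> op H) (A B : nat -> set (op H))
    (e : nat -> op H) (lam : R[i]) : Prop := FramedTower {
  ft_A0 : forall x, A 0%N x -> exists c : I -> R[i], x = (fun h => \sum_i c i *: a i h);
  ft_B0 : forall x, B 0%N x <-> exists c : R[i], x = (fun h => c *: h);
  ft_subA0 : subalgebra (A 0%N);
  ft_subA1 : subalgebra (A 1%N);
  ft_subB1 : subalgebra (B 1%N);
  ft_starA0 : star_closed dot (A 0%N);
  ft_starA1 : star_closed dot (A 1%N);
  ft_starB1 : star_closed dot (B 1%N);
  ft_A01 : A 0%N `<=` A 1%N;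
  ft_BA1 : B 1%N `<=` A 1%N;
  ft_a : forall i, [/\ A 0%N (a i), A 0%N (a' i) & adjoint_op dot (a i) (a' i)];
  ft_q : forall j, [/\ B 1%N (q j), B 1%N (q' j) & adjoint_op dot (q j) (q' j)];
  ft_B1 : forall x, B 1%N x -> exists c : J -> R[i], x = (fun h => \sum_j c j *: q j h);
  ft_on_a : forall i j, vec_trace dot Om (a' i \o a j) = (i == j)%:R;
  ft_on_q : forall i j, vec_trace dot Om (q' i \o q j) = (i == j)%:R;
  ft_square : forall x y, A 0%N x -> B 1%N y ->
    vec_trace dot Om (x \o y) = vec_trace dot Om x * vec_trace dot Om y;
  ft_nondeg : forall x, A 1%N x -> exists2 b : I -> op H,
    (forall i, B 1%N (b i)) & x = (fun h => \sum_i a i (b i h));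
  ft_proj : forall k, projection_op dot (e k.+2);
  ft_bc : forall k, basic_construction dot Om (A k) (A k.+1) (e k.+2) (A k.+2);
  ft_B : forall k, B k.+2 = algebra_gen (B k.+1 `|` [set e k.+2]);
  ft_gns : gns_trace_vector dot (\bigcup_k A k) Om;
  ft_markov : forall k x, A k.+1 x ->
    vec_trace dot Om (x \o e k.+2) = lam * vec_trace dot Om x }.

Section Tower.
Context {R : realType} {H : completeNormedModType R[i]}.
Variable dot : {dot H for (@Num.conj R[i])}.
Hypothesis Hdot : norm_of_dot dot.
Local Notation C := R[i].
Variables (Om : H) (I J : finType) (a a' : I -> op H) (q q' : J -> op H).
Variables (A B : nat -> set (op H)) (e : nat -> op H) (lam : C).
Hypothesis T : framed_tower dot Om a a' q q' A B e lam.
Local Notation tau := (vec_trace dot Om).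

Lemma Om_neq0 : Om != 0.
Proof. by have [Om1 _ _] := ft_gns T; rewrite -normr_eq0 Om1 oner_eq0. Qed.

Lemma A_gen k : A k.+2 = algebra_gen (A k.+1 `|` [set e k.+2]).
Proof. by have [] := ft_bc T k. Qed.

Lemma subalgebra_A k : subalgebra (A k).
Proof.
case: k => [|[|k]]; [exact: ft_subA0 T|exact: ft_subA1 T|].
by rewrite A_gen; exact: subalgebra_gen.
Qed.

Lemma subalgebra_B k : subalgebra (B k).
Proof.
case: k => [|[|k]]; last by rewrite (ft_B T); exact: subalgebra_gen.
- split=> [|c x y /(ft_B0 T)[d ->] /(ft_B0 T)[d' ->]|x y /(ft_B0 T)[d ->] /(ft_B0 T)[d' ->]];
    apply/(ft_B0 T).
  + by exists 1; apply/funext => h; rewrite scale1r.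
  + by exists (c * d + d'); apply/funext => h; rewrite scalerA scalerDl.
  + by exists (d * d'); apply/funext => h /=; rewrite scalerA.
- exact: ft_subB1 T.
Qed.

Lemma e_bounded k : bounded_op (e k.+2).
Proof. by have [] := ft_proj T k. Qed.

Lemma e_adjoint k : adjoint_op dot (e k.+2) (e k.+2).
Proof. by have [] := ft_proj T k. Qed.

Lemma e_idem k h : e k.+2 (e k.+2 h) = e k.+2 h.
Proof. by have [_ _ ee] := ft_proj T k; rewrite -[RHS]/(e k.+2 h) -{3}ee. Qed.

Lemma e_linear k : linear (e k.+2).
Proof. exact: adjoint_lin (e_adjoint k). Qed.

Lemma star_closedU1 (S : set (op H)) k :
  star_closed dot S -> star_closed dot (S `|` [set e k.+2]).
Proof.
move=> sS x [/sS[bx [y Sy xy]]|->].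
  by split=> //; exists y => //; left.
by split; [exact: e_bounded|exists (e k.+2); [right|exact: e_adjoint]].
Qed.

Lemma star_closed_A k : star_closed dot (A k).
Proof.
elim: k => [|[|k] IH]; [exact: ft_starA0 T|exact: ft_starA1 T|].
by rewrite A_gen; apply/star_closed_gen/star_closedU1.
Qed.

Lemma star_closed_B k : star_closed dot (B k).
Proof.
elim: k => [|[|k] IH].
- move=> x /(ft_B0 T)[c ->]; split.
    have := bounded_op_comb c (@bounded_op_id R H) (@bounded_op0 R H).
    by congr bounded_op; apply/funext => h /=; rewrite addr0.
  exists (fun h => c^* *: h); last exact: adjoint_scal.
  by apply/(ft_B0 T); exists c^*.
- exact: ft_starB1 T.
by rewrite (ft_B T); apply/star_closed_gen/star_closedU1.
Qed.

Lemma A_step k : A k `<=` A k.+1.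
Proof.
case: k => [|k]; first exact: ft_A01 T.
by rewrite A_gen => x Ax; apply: sub_algebra_gen; left.
Qed.

Lemma A_mono k l : (k <= l)%N -> A k `<=` A l.
Proof.
elim: l => [|l IH]; first by rewrite leqn0 => /eqP->.
by rewrite leq_eqVlt ltnS => /orP[/eqP->//|/IH kl] x /kl /A_step.
Qed.

Lemma B_step k : B k `<=` B k.+1.
Proof.
case: k => [|k].
  by move=> x /(ft_B0 T)[c ->]; exact: subalgebra_scal (ft_subB1 T).
by rewrite (ft_B T) => x Ax; apply: sub_algebra_gen; left.
Qed.

Lemma B_mono k l : (k <= l)%N -> B k `<=` B l.
Proof.
elim: l => [|l IH]; first by rewrite leqn0 => /eqP->.
by rewrite leq_eqVlt ltnS => /orP[/eqP->//|/IH kl] x /kl /B_step.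
Qed.

Lemma e_in_B k : B k.+2 (e k.+2).
Proof. by rewrite (ft_B T); apply: sub_algebra_gen; right. Qed.

Lemma B_sub_A k : B k `<=` A k.
Proof.
elim: k => [|[|k] IH]; last 2 first.
- exact: ft_BA1 T.
- rewrite (ft_B T) A_gen; apply: algebra_gen_mono => x [/IH|->]; [by left|by right].
by move=> x /(ft_B0 T)[c ->]; exact: subalgebra_scal (ft_subA0 T).
Qed.

Lemma e_in_A k : A k.+2 (e k.+2).
Proof. exact/B_sub_A/e_in_B. Qed.

Lemma A_bounded k x : A k x -> bounded_op x.
Proof. by move=> /star_closed_A[]. Qed.

Lemma A_linear k x : A k x -> linear x.
Proof. by move=> /A_bounded/bounded_op_lin. Qed.

Lemma A_adjoint k x : A k x -> exists2 y, A k y & adjoint_op dot x y.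
Proof. by move=> /star_closed_A[]. Qed.

Lemma tau_cyclic k l x y : A k x -> A l y -> tau (x \o y) = tau (y \o x).
Proof.
by move=> Ax Ay; have [_ tr _] := ft_gns T; apply: tr; [exists k|exists l].
Qed.

Lemma tauZ c x : tau (fun h => c *: x h) = c * tau x.
Proof. by rewrite /vec_trace dotZl. Qed.

Lemma tau_scal c : tau (fun h => c *: h) = c.
Proof.
rewrite /vec_trace dotZl -Hdot; have [-> _ _] := ft_gns T.
by rewrite expr1n mulr1.
Qed.

Lemma tau_sum (K : Type) (r : seq K) (F : K -> op H) :
  tau (fun h => \sum_(i <- r) F i h) = \sum_(i <- r) tau (F i).
Proof. by rewrite /vec_trace dot_suml. Qed.

Definition orbit_A := orbit_vec (\bigcup_k A k) Om.

Lemma orbit_A_dense : closure orbit_A = setT.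
Proof. by have [] := ft_gns T. Qed.

Lemma orbit_AE v : orbit_A v -> exists k x, A k x /\ v = x Om.
Proof. by move=> [x [k _ Ax] <-]; exists k, x. Qed.

Lemma mem_orbit_A k x : A k x -> orbit_A (x Om).
Proof. by move=> Ax; exists x => //; exists k. Qed.

Lemma A_eq k l x y : A k x -> A l y ->
  (forall m z, A m z -> x (z Om) = y (z Om)) -> x = y.
Proof.
move=> /A_adjoint[x' _ xx'] /A_adjoint[y' _ yy'] xy.
apply: (dense_adjoint_eq Hdot orbit_A_dense xx' yy') => v /orbit_AE[m [z [Az ->]]].
exact: xy Az.
Qed.

(** The trace vector is separating because it is also cyclic for right
    multiplications: |x y Om|^2 = tau(x^* x y y^* ). *)
Lemma separating k x : A k x -> x Om = 0 -> x = (fun=> 0).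
Proof.
move=> Ax xOm; apply: (A_eq Ax (subalgebra0 (subalgebra_A k))) => m y Ay.
have [x' Ax' xx'] := A_adjoint Ax; have [y' Ay' yy'] := A_adjoint Ay.
apply: (dot_eq0 (dot := dot)); rewrite -{1}(adjoint_sym xx') -(adjoint_sym yy').
set n := maxn k m.
have Axn : A n x by apply: A_mono Ax; rewrite leq_maxl.
have Axn' : A n x' by apply: A_mono Ax'; rewrite leq_maxl.
have Ayn : A n y by apply: A_mono Ay; rewrite leq_maxr.
have Ayn' : A n y' by apply: A_mono Ay'; rewrite leq_maxr.
have sn := subalgebra_A n.
have := tau_cyclic (subalgebra_comp sn (subalgebra_comp sn Ayn' Axn') Axn) Ayn.
rewrite /vec_trace /= => ->.
rewrite xOm (lin0 (A_linear Axn')) (lin0 (A_linear Ayn')) (lin0 (A_linear Ayn)).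
by rewrite linear0l.
Qed.

Lemma bcA_comm k y : A k y -> forall h, e k.+2 (y h) = y (e k.+2 h).
Proof.
move=> Ay h; have tr x z := @tau_cyclic k.+1 k.+1 x z.
have := bc_comm (subalgebra_A k) (subalgebra_A k.+1) (@A_step k)
  (@star_closed_A k) (ft_bc T k) Ay.
by move=> /(congr1 (fun f => f h)).
Qed.

Lemma bcA_compress k x y : A k.+1 x -> expects dot Om (A k) x y ->
  forall h, e k.+2 (x (e k.+2 h)) = y (e k.+2 h).
Proof.
move=> Ax xy h; have tr x z := @tau_cyclic k.+1 k.+1 x z.
have := bc_compress (subalgebra_A k) (subalgebra_A k.+1) (@A_step k)
  (@star_closed_A k) tr (ft_bc T k) Ax xy.
by move=> /(congr1 (fun f => f h)).
Qed.

(** * Commuting squares up the tower *)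

(** The commuting square condition for B_k, A_k, B_(k+1), A_(k+1), in the form
    E_(A_k)(B_(k+1)) = B_k. *)
Definition square_at k := forall b, B k.+1 b ->
  exists2 y, B k y & expects dot Om (A k) b y.

Lemma expects_B1 b : B 1 b -> expects dot Om (A 0) b (fun h => tau b *: h).
Proof.
move=> Bb; split; first exact: subalgebra_scal (ft_subA0 T).
move=> c Ac; have [c' Ac' cc'] := A_adjoint Ac.
rewrite -!(adjoint_sym cc') -[LHS]/(tau (c' \o b)) (ft_square T Ac' Bb).
rewrite (linZ (tau b) Om (A_linear Ac')) dotZl -[dot _ _]/(tau c').
by rewrite mulrC.
Qed.

Lemma square_at0 : square_at 0.
Proof.
move=> b Bb; exists (fun h => tau b *: h); last exact: expects_B1.
by apply/(ft_B0 T); exists (tau b).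
Qed.

(** The Markov property says that E(e) = lam on A_(k+1); under
    the trace, c can be carried round to the left of b, so E(b e c) = lam b c. *)
Lemma markov_expects k b c : A k.+1 b -> A k.+1 c ->
  expects dot Om (A k.+1) (fun h => b (e k.+2 (c h))) (fun h => lam *: b (c h)).
Proof.
move=> Ab Ac; have s := subalgebra_A k.+1; split.
  exact: subalgebraZ s (subalgebra_comp s Ab Ac).
move=> d Ad; have [d' Ad' dd'] := A_adjoint Ad.
rewrite -!(adjoint_sym dd') (linZ lam _ (A_linear Ad')) dotZl.
have Adb := subalgebra_comp s Ad' Ab.
have Ae := subalgebra_comp (subalgebra_A k.+2) (A_step Adb) (e_in_A k).
have := tau_cyclic Ae Ac; rewrite {1}/vec_trace /= => ->.
have := ft_markov T (subalgebra_comp s Ac Adb).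
rewrite -[tau (_ \o e _)]/(tau (c \o ((d' \o b) \o e k.+2))) => ->.
congr (_ * _); have := tau_cyclic Ac Adb; rewrite /vec_trace /= => <- //.
Qed.

Definition comb_closed (P : op H -> Prop) :=
  forall c x y, P x -> P y -> P (fun h => c *: x h + y h).

(** Since e b e is E(b) e, the span of B_(k+1) and B_(k+1) e B_(k+1) is
    already an algebra. *)
Lemma B_ind k (P : op H -> Prop) : square_at k -> comb_closed P ->
  (forall b, B k.+1 b -> P b) ->
  (forall b c, B k.+1 b -> B k.+1 c -> P (fun h => b (e k.+2 (c h)))) ->
  forall x, B k.+2 x -> P x.
Proof.
move=> sq Pl PB PBeB.
pose base Q := [/\ comb_closed Q, forall b, B k.+1 b -> Q b &
  forall b c, B k.+1 b -> B k.+1 c -> Q (fun h => b (e k.+2 (c h)))].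
pose V x := forall Q, base Q -> Q x.
have Vl : comb_closed V 
  by move=> c x y Vx Vy Q bQ; case: (bQ) => Ql _ _; apply: Ql; [exact: Vx|exact: Vy].
have VB b : B k.+1 b -> V b by move=> Bb Q [_ + _]; apply.
have VBeB b c : B k.+1 b -> B k.+1 c -> V (fun h => b (e k.+2 (c h))).
  by move=> Bb Bc Q [_ _]; apply.
have sB := subalgebra_B k.+1; have [B1 _ _] := sB.
suff left_V x : B k.+2 x -> forall z, V z -> V (x \o z).
  by move=> x /left_V/(_ idfun (VB _ B1))/(_ P); apply.
rewrite (ft_B T) => gx; apply: (gx (fun x => forall z, V z -> V (x \o z))).
  split=> [//|c {gx}x y Vx Vy z Vz|{gx}x y Vx Vy z Vz].
    exact: (Vl c _ _ (Vx z Vz) (Vy z Vz)).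
  exact: (Vx _ (Vy z Vz)).
move=> y [By|->] z Vz;
  [apply: (Vz (fun z => V (y \o z)))|apply: (Vz (fun z => V (e k.+2 \o z)))];
  split=> [c {gx}x w|b Bb|b c Bb Bc].
- have ly := A_linear (B_sub_A By).
  move=> Vx Vw; have := Vl c _ _ Vx Vw; congr V.
  by apply/funext => h; rewrite /= ly.
- exact: VB _ (subalgebra_comp sB By Bb).
- exact: (VBeB (y \o b) c (subalgebra_comp sB By Bb) Bc).
- move=> Vx Vw; have := Vl c _ _ Vx Vw; congr V.
  by apply/funext => h; rewrite /= e_linear.
- exact: (VBeB idfun b).
have [z' Bz' bz'] := sq b Bb.
have := VBeB z' c (B_step Bz') Bc; congr V; apply/funext => h /=.
by rewrite (bcA_compress (B_sub_A Bb) bz').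
Qed.

(** The square at k makes B_(k+2) the span of B_(k+1) and B_(k+1) e B_(k+1),
    where the expectation onto A_(k+1) is explicit. *)
Lemma square_at_all k : square_at k.
Proof.
elim: k => [|k IH]; first exact: square_at0.
apply: (B_ind (P := fun x => exists2 y, B k.+1 y & expects dot Om (A k.+1) x y) IH)
  => [c x y [x' Bx' [Ax' xx']] [y' By' [Ay' yy']]|b Bb|b c Bb Bc].
- exists (fun h => c *: x' h + y' h).
    by have [_ + _] := subalgebra_B k.+1; apply.
  split; first by have [_ + _] := subalgebra_A k.+1; apply.
  by move=> d Ad; rewrite !dotPl xx'// yy'.
- by exists b => //; split=> //; exact: B_sub_A.
exists (fun h => lam *: b (c h)).
  exact: subalgebraZ (subalgebra_B _) (subalgebra_comp (subalgebra_B _) Bb Bc).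
by apply: markov_expects; exact: B_sub_A.
Qed.

(** Against an element of A_0, an element of B_(k+1) may be replaced by its
    expectation in B_k, and so down to the scalars B_0. *)
Lemma tau_mul k f b : A 0 f -> B k b -> tau (f \o b) = tau f * tau b.
Proof.
move=> Af; have [f' Af' ff'] := A_adjoint Af.
elim: k b => [|k IH] b.
  move=> /(ft_B0 T)[c ->]; rewrite tau_scal mulrC -tauZ.
  by congr tau; apply/funext => h /=; rewrite linZ//; exact: A_linear Af.
move=> /square_at_all[y By [Ay yb]].
have A1 : A k idfun by case: (subalgebra_A k).
have tyb : tau b = tau y by exact: (yb idfun A1).
rewrite tyb -IH// /vec_trace /= !ff' yb//.
exact: A_mono Af'.
Qed.

(** * Expansion of A_k over B_k along the basis of A_0 *)

(** A_k = A_0 B_k: the right side contains 1 and is stable under left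
    multiplication by A_(k-1), by induction, and by e_k, which commutes with
    A_0; and these generate A_k. *)
Lemma A_expand k x : A k x -> exists2 b : I -> op H,
  (forall i, B k (b i)) & x = (fun h => \sum_i a i (b i h)).
Proof.
have aA0 i : A 0 (a i) by have [] := ft_a T i.
have alin i : linear (a i) by exact: A_linear (aA0 i).
elim: k x => [|[|k] IH] x.
- move=> /(ft_A0 T)[c ->]; exists (fun i h => c i *: h) => [i|].
    by apply/(ft_B0 T); exists (c i).
  by apply/funext => h; apply: eq_bigr => i _; rewrite linZ.
- exact: (ft_nondeg T).
have sB := subalgebra_B k.+2; have [B1 Bl _] := sB.
pose X := [set x | exists2 b : I -> op H,
  (forall i, B k.+2 (b i)) & x = (fun h => \sum_i a i (b i h))].
have Xl : comb_closed X.
  move=> c _ _ [b Bb ->] [d Bd ->]; exists (fun i h => c *: b i h + d i h).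
    by move=> i; exact: Bl.
  apply/funext => h; rewrite scaler_sumr -big_split; apply: eq_bigr => i _ /=.
  by rewrite alin.
have X0 : X (fun=> 0).
  exists (fun _ _ => 0) => [i|]; first exact: subalgebra0.
  by apply/funext => h; rewrite big1// => i _; exact: lin0.
have Xsum (F : I -> op H) : (forall i, X (F i)) -> X (fun h => \sum_i F i h).
  move=> XF; elim: (index_enum I) => [|i s IHs].
    by move: X0; congr X; apply/funext => h; rewrite big_nil.
  have := Xl 1 _ _ (XF i) IHs; congr X; apply/funext => h.
  by rewrite big_cons scale1r.
have X1 : X idfun.
  have [|b Bb bE] := IH idfun; first by case: (subalgebra_A k.+1).
  by exists b => // i; apply: B_step.
suff left_X : A k.+2 x -> forall z, X z -> X (x \o z).
  by move=> /left_X/(_ _ X1).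
rewrite A_gen => gx; apply: (gx (fun x => forall z, X z -> X (x \o z))).
  split=> [//|c {gx}x y Xx Xy z Xz|{gx}x y Xx Xy z Xz].
    exact: (Xl c _ _ (Xx z Xz) (Xy z Xz)).
  exact: (Xx _ (Xy z Xz)).
move=> y [Ay|->] _ [b Bb ->].
  have ly := A_linear Ay.
  have /Xsum : forall i, X (y \o a i \o b i).
    move=> i; have Aya : A k.+1 (y \o a i).
      by apply: subalgebra_comp => //; [exact: subalgebra_A|exact: A_mono (aA0 i)].
    have [d Bd ->] := IH _ Aya; exists (fun j => d j \o b i) => // j.
    exact: subalgebra_comp (B_step (Bd j)) (Bb i).
  by congr X; apply/funext => h /=; rewrite lin_sum.
exists (fun i => e k.+2 \o b i) => [i|].
  exact: subalgebra_comp (e_in_B k) (Bb i).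
apply/funext => h /=; rewrite (lin_sum _ _ _ (@e_linear k)).
by apply: eq_bigr => i _; rewrite (bcA_comm (A_mono (leq0n k) (aA0 i))).
Qed.

Lemma A_expand_right k x : A k x -> exists2 b : I -> op H,
  (forall i, B k (b i)) & x = (fun h => \sum_i b i (a' i h)).
Proof.
move=> Ax; have [x' Ax' xx'] := A_adjoint Ax.
have [b Bb bE] := A_expand Ax'.
have /choice[b' b'P] : forall i, exists b', B k b' /\ adjoint_op dot (b i) b'.
  by move=> i; have [_ [y By by']] := star_closed_B (Bb i); exists y.
exists b' => [i|]; first by case: (b'P i).
apply/funext => h; apply: (dot_inj (dot := dot)) => w.
rewrite xx' bE dot_suml dot_sumr; apply: eq_bigr => i _.
have [_ bb'] := b'P i; have [_ _ aa'] := ft_a T i.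
by rewrite (adjoint_sym bb') (adjoint_sym aa').
Qed.

End Tower.

(** * The Jones relations *)

Section JonesRelations.
Context {R : realType} {H : completeNormedModType R[i]}.
Variable dot : {dot H for (@Num.conj R[i])}.
Hypothesis Hdot : norm_of_dot dot.
Local Notation C := R[i].
Variables (Om : H) (I J : finType) (a a' : I -> op H) (q q' : J -> op H).
Variables (A B : nat -> set (op H)) (e : nat -> op H) (lam : C).
Hypothesis T : framed_tower dot Om a a' q q' A B e lam.
Local Notation tau := (vec_trace dot Om).

Lemma tau_e k : tau (e k.+2) = lam.
Proof.
have A1 : A k.+1 idfun by case: (subalgebra_A T k.+1).
rewrite -[tau _]/(tau (idfun \o e k.+2)) (ft_markov T A1).
rewrite -[X in _ * X]/(dot Om Om) -Hdot; have [-> _ _] := ft_gns T.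
by rewrite expr1n mulr1.
Qed.

Lemma lamE k : lam = dot (e k.+2 Om) (e k.+2 Om).
Proof. by rewrite -(tau_e k) -(e_adjoint T) (e_idem T). Qed.

Lemma lam_ge0 : 0 <= lam.
Proof. by rewrite (lamE 0) dot_ge0. Qed.

Lemma lam_neq0 : lam != 0.
Proof.
apply/eqP; rewrite (lamE 0) => /dot_eq0/(separating Hdot T (e_in_A T 0)).
by apply: (bc_e_neq0 (ft_subA0 T) (ft_subA1 T) (ft_A01 T) (ft_bc T 0)); exact: Om_neq0 T.
Qed.

Lemma jones_up k h : e k.+3 (e k.+2 (e k.+3 h)) = lam *: e k.+3 h.
Proof.
have A1 : A k.+1 idfun by case: (subalgebra_A T k.+1).
exact: (bcA_compress T (e_in_A T k) (markov_expects T A1 A1)).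
Qed.

(** The norm of (f g f - lam f) Om, for f = e_k and g = e_(k+1), is computed
    from g f g = lam g and the Markov property alone. *)
Lemma jones_down k h : e k.+2 (e k.+3 (e k.+2 h)) = lam *: e k.+2 h.
Proof.
set f := e k.+2; set g := e k.+3.
have Af : A k.+3 f by apply: A_step T _ _ (e_in_A T k).
have Ag : A k.+3 g by exact: e_in_A T k.+1.
have sA := subalgebra_A T k.+3.
have Afg := subalgebra_comp sA Af Ag; have Afgf := subalgebra_comp sA Afg Af.
have adf : adjoint_op dot f f := e_adjoint T k.
have adg : adjoint_op dot g g := e_adjoint T k.+1.
have ff u : f (f u) = f u := e_idem T k u.
have gg u : g (g u) = g u := e_idem T k.+1 u.
have lf : linear f := e_linear T k.
have gfg u : g (f (g u)) = lam *: g u := jones_up k u.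
have lamC : lam^* = lam by exact/geC0_conj/lam_ge0.
have tfgf : dot (f (g (f Om))) Om = lam ^+ 2.
  have := tau_cyclic T Afg Af; rewrite {1}/vec_trace /= => ->.
  rewrite -[LHS]/(dot (f (f (g Om))) Om) ff.
  have := ft_markov T (e_in_A T k); rewrite -[tau (_ \o _)]/(dot (f (g Om)) Om) => ->.
  by rewrite tau_e.
have := subalgebraB sA Afgf (subalgebraZ lam sA Af) => /= Az.
have /(separating Hdot T Az) /(congr1 (fun z => z h)) /= :
    f (g (f Om)) - lam *: f Om = 0.
  apply: (dot_eq0 (dot := dot)); rewrite dotBl !dotBr !(dotZl, dotZr).
  have -> : dot (f (g (f Om))) (f (g (f Om))) = lam * lam ^+ 2.
    by rewrite -adf ff -adg -adf gfg (linZ _ _ lf) dotZl tfgf.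
  have -> : dot (f (g (f Om))) (f Om) = lam ^+ 2 by rewrite -adf ff tfgf.
  have -> : dot (f Om) (f (g (f Om))) = lam ^+ 2.
    by rewrite dotC -adf ff tfgf rmorphXn /= lamC.
  by rewrite -(lamE k) lamC; ring.
by move=> /eqP; rewrite subr_eq0 => /eqP.
Qed.

(** * Matrix units in the algebras B_k *)

(** V_(K,j) = lam^(-K) q_j e_2 e_3 ... e_(2K+2): the elements
    lam^(-K) q_j e_2 ... e_(2K+1) form an orthonormal basis of B_(2K+1) over
    B_(2K), here multiplied by the next Jones projection. *)
Fixpoint Vop (K : nat) (j : J) : op H :=
  if K is K'.+1 then fun h => lam^-1 *: Vop K' j (e K'.*2.+3 (e K'.*2.+4 h))
  else q j \o e 2.

Fixpoint Vadj (K : nat) (j : J) : op H :=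
  if K is K'.+1 then fun h => lam^-1 *: e K'.*2.+4 (e K'.*2.+3 (Vadj K' j h))
  else e 2 \o q' j.

Lemma Vop_B K j : B K.*2.+2 (Vop K j) /\ B K.*2.+2 (Vadj K j).
Proof.
have [Bq Bq' _] := ft_q T j.
elim: K => [|K [IH IH']] /=.
  split; apply: (subalgebra_comp (subalgebra_B T 2)); try exact: (e_in_B T 0);
    exact: (B_step T).
have sB := subalgebra_B T K.*2.+4.
have BV : B K.*2.+4 (Vop K j) by exact/(B_step T)/(B_step T).
have BV' : B K.*2.+4 (Vadj K j) by exact/(B_step T)/(B_step T).
have Be3 : B K.*2.+4 (e K.*2.+3) by exact/(B_step T)/(e_in_B T).
have Be4 : B K.*2.+4 (e K.*2.+4) by exact/(e_in_B T).
split; apply: (subalgebraZ _ sB).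
  exact: subalgebra_comp sB BV (subalgebra_comp sB Be3 Be4).
exact: subalgebra_comp sB Be4 (subalgebra_comp sB Be3 BV').
Qed.

Lemma Vop_linear K j : linear (Vop K j).
Proof. by have [/(B_sub_A T)/(A_linear T)] := Vop_B K j. Qed.

Lemma Vadj_linear K j : linear (Vadj K j).
Proof. by have [_ /(B_sub_A T)/(A_linear T)] := Vop_B K j. Qed.

Lemma Vop_adjoint K j : adjoint_op dot (Vop K j) (Vadj K j).
Proof.
have lamC : (lam^-1)^* = lam^-1 by rewrite fmorphV /= (geC0_conj lam_ge0).
have [_ _ qq'] := ft_q T j.
elim: K => [|K IH] h k /=; first by rewrite qq' (e_adjoint T).
by rewrite dotZl IH !(e_adjoint T) dotZr lamC.
Qed.

Lemma Vop_e K j h : Vop K j (e K.*2.+2 h) = Vop K j h.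
Proof. by case: K => [|K] /=; rewrite (e_idem T). Qed.

Lemma e_Vadj K j h : e K.*2.+2 (Vadj K j h) = Vadj K j h.
Proof.
by case: K => [|K] /=; rewrite ?(linZ _ _ (e_linear T _)) (e_idem T).
Qed.

Lemma Vadj_Vop K i j h :
  Vadj K i (Vop K j h) = (i == j)%:R *: e K.*2.+2 h.
Proof.
elim: K h => [|K IH] h /=.
  have [_ Bi _] := ft_q T i; have [Bj _ _] := ft_q T j.
  have Bij := subalgebra_comp (ft_subB1 T) Bi Bj.
  have := bcA_compress T (ft_BA1 T Bij) (expects_B1 T Bij) h.
  by rewrite (ft_on_q T).
rewrite (linZ _ _ (Vadj_linear K i)) IH !(linZ _ _ (e_linear T _)) jones_up.
rewrite (linZ _ _ (e_linear T _)) jones_up !scalerA.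
by congr (_ *: _); field; exact: lam_neq0.
Qed.

Lemma VopS K j h :
  Vop K.+1 j h = lam^-1 *: Vop K j (e K.*2.+3 (e K.*2.+4 h)).
Proof. by []. Qed.

Lemma VadjS K j h :
  Vadj K.+1 j h = lam^-1 *: e K.*2.+4 (e K.*2.+3 (Vadj K j h)).
Proof. by []. Qed.

Arguments Vop : simpl never.
Arguments Vadj : simpl never.

(** It is enough to test on A_1 e_2 = B_1 e_2 A_0, and on B_1 e_2 the sum is the
    expansion along the orthonormal basis q. *)
Lemma Vop0_complete h : \sum_j Vop 0 j (Vadj 0 j h) = h.
Proof.
have sA := subalgebra_A T 2.
have AV j : A 2 (Vop 0 j \o Vadj 0 j).
  by have [/(B_sub_A T) ? /(B_sub_A T) ?] := Vop_B 0 j; exact: subalgebra_comp sA _ _.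
have A1 : A 2 idfun by case: sA.
have := subalgebraB sA (subalgebra_sum (index_enum J) sA AV) A1 => /= Az.
suff /(congr1 (fun z => z h)) /= : (fun h => \sum_j Vop 0 j (Vadj 0 j h) - h) = (fun=> 0).
  by move=> /eqP; rewrite subr_eq0 => /eqP.
apply: (bc_zero (ft_subA0 T) (ft_subA1 T) (ft_A01 T) (ft_bc T 0) Az) => x Ax.
have [b Bb bE] := A_expand_right T Ax.
have vb c u : B 1 c -> \sum_j Vop 0 j (Vadj 0 j (c (e 2 u))) = c (e 2 u).
  move=> /(ft_B1 T)[d ->].
  under eq_bigr => j _ do rewrite (lin_sum _ _ _ (Vadj_linear 0 j))
    (lin_sum _ _ _ (Vop_linear 0 j)).
  rewrite exchange_big /=; apply: eq_bigr => l _.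
  rewrite (bigD1 l)//= big1 ?addr0 => [|j jl].
    rewrite (linZ _ _ (Vadj_linear 0 l)) (linZ _ _ (Vop_linear 0 l)).
    by rewrite -[q l (e 2 u)]/(Vop 0 l u) Vadj_Vop eqxx scale1r Vop_e.
  rewrite (linZ _ _ (Vadj_linear 0 j)) -[q l (e 2 u)]/(Vop 0 l u) Vadj_Vop.
  by rewrite (negbTE jl) scale0r scaler0 (lin0 (Vop_linear 0 j)).
apply/funext => u /=; apply/eqP; rewrite subr_eq0; apply/eqP; rewrite bE.
have ea i v : e 2 (a' i v) = a' i (e 2 v).
  by have [_ Aa' _] := ft_a T i; rewrite (bcA_comm T Aa').
transitivity (\sum_i b i (e 2 (a' i u))); last first.
  by apply: eq_bigr => i _; rewrite ea.
under eq_bigr => j _.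
  under eq_bigr => i _ do rewrite -ea.
  rewrite (lin_sum _ _ _ (Vadj_linear 0 j)) (lin_sum _ _ _ (Vop_linear 0 j)).
  over.
by rewrite exchange_big /=; apply: eq_bigr => i _; exact: vb.
Qed.

Lemma Vop_complete K h : \sum_j Vop K j (Vadj K j h) = h.
Proof.
elim: K h => [|K IH] h; first exact: Vop0_complete.
rewrite -[RHS]IH; apply: eq_bigr => j _.
have down u : Vop K j (e K.*2.+3 (Vadj K j u)) = lam *: Vop K j (Vadj K j u).
  by rewrite -Vop_e -[in LHS]e_Vadj jones_down e_Vadj (linZ _ _ (Vop_linear K j)).
rewrite VopS VadjS !(linZ _ _ (e_linear T _)) (linZ _ _ (Vop_linear K j)) (e_idem T).
rewrite jones_down (linZ _ _ (Vop_linear K j)) down !scalerA.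
rewrite -[RHS]scale1r; congr (_ *: _); field; exact: lam_neq0.
Qed.

(** A system of matrix units W_i W_j^* for a full matrix algebra inside B_k,
    placed so that W_i x W_j^* multiplies like a matrix with entries x in A_0:
    this only needs eps = W_i^* W_i to commute with A_0. *)
Definition matrix_frame (k : nat) (L : finType) (W W' : L -> op H) (eps : op H) :=
  [/\ forall i, [/\ B k (W i), B k (W' i) & adjoint_op dot (W i) (W' i)],
      forall i j h, W' i (W j h) = (i == j)%:R *: eps h,
      forall i h, W i (eps h) = W i h,
      forall x h, A 0 x -> eps (x h) = x (eps h) &
      forall h, \sum_i W i (W' i h) = h].

(** Words W = V_(K,j_K) ... V_(1,j_1) V_(0,j_0), with eps = e_(2K+2) ... e_4 e_2:
    each e_(2K+4) commutes with the shorter words, which lie in A_(2K+2). *)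
Lemma matrix_frames K : exists (L : finType) (W W' : L -> op H) (eps : op H),
  matrix_frame K.*2.+2 W W' eps /\ #|L| = (#|J| ^ K.+1)%N.
Proof.
elim: K => [|K [L [W [W' [eps [[WB WW We epsA Wc] cardL]]]]]].
  exists J, (Vop 0), (Vadj 0), (e 2); split; last by rewrite expn1.
  split=> [j|||x h Ax|].
  - by have [? ?] := Vop_B 0 j; split=> //; exact: Vop_adjoint.
  - exact: Vadj_Vop.
  - exact: Vop_e.
  - exact: (bcA_comm T Ax).
  - exact: Vop_complete.
exists (J * L)%type, (fun ij => Vop K.+1 ij.1 \o W ij.2),
  (fun ij => W' ij.2 \o Vadj K.+1 ij.1), (e K.*2.+4 \o eps).
split; last by rewrite card_prod cardL -expnS.
have eW i h : e K.*2.+4 (W i h) = W i (e K.*2.+4 h).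
  by have [/(B_sub_A T) Ai _ _] := WB i; rewrite (bcA_comm T Ai).
have eW' i h : e K.*2.+4 (W' i h) = W' i (e K.*2.+4 h).
  by have [_ /(B_sub_A T) Ai _] := WB i; rewrite (bcA_comm T Ai).
have linW' i : linear (W' i) by have [_ /(B_sub_A T)/(A_linear T)] := WB i.
split=> [[j i]|[j i] [j' i'] h|[j i] h|x h Ax|h] /=.
- have [BV BV'] := Vop_B K.+1 j; have [BW BW' WW'] := WB i.
  have sB := subalgebra_B T K.*2.+4.
  have up x : B K.*2.+2 x -> B K.*2.+4 x by move=> ?; exact/(B_step T)/(B_step T).
  split; first exact: subalgebra_comp sB BV (up _ BW).
    exact: subalgebra_comp sB (up _ BW') BV'.
  exact: adjoint_comp (Vop_adjoint K.+1 j) WW'.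
- rewrite Vadj_Vop (linZ _ _ (linW' i)) -[e _]/(e K.*2.+4) -eW' WW.
  by rewrite (linZ _ _ (e_linear T _)) scalerA -natrM mulnb xpair_eqE.
- by rewrite -eW -[e _]/(e K.+1.*2.+2) Vop_e We.
- by rewrite epsA// (bcA_comm T (A_mono T (leq0n _) Ax)).
- rewrite -[RHS](Vop_complete K.+1) 
    -(pair_bigA _ (fun j i => Vop K.+1 j (W i (W' i (Vadj K.+1 j h))))) /=.
  by apply: eq_bigr => j _; rewrite -(lin_sum _ _ _ (Vop_linear K.+1 j)) Wc.
Qed.

End JonesRelations.

(** * Right multiplications *)

Section ConditionalExpectation.
Context {R : realType} {H : completeNormedModType R[i]}.
Variable dot : {dot H for (@Num.conj R[i])}.
Hypothesis Hdot : norm_of_dot dot.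
Local Notation C := R[i].
Variables (Om : H) (I J : finType) (a a' : I -> op H) (q q' : J -> op H).
Variables (A B : nat -> set (op H)) (e : nat -> op H) (lam : C).
Hypothesis T : framed_tower dot Om a a' q q' A B e lam.
Local Notation tau := (vec_trace dot Om).

Local Notation UA := (\bigcup_k A k).
Local Notation UB := (\bigcup_k B k).
Local Notation M := (weak_closure dot UA).
Local Notation N := (weak_closure dot UB).

Lemma A_common k l x y : A k x -> A l y -> exists2 m, A m x & A m y.
Proof.
move=> Ax Ay; exists (maxn k l); [apply: A_mono T _ _ _ _ Ax|apply: A_mono T _ _ _ _ Ay].
  exact: leq_maxl.
exact: leq_maxr.
Qed.

Lemma B_common k l x y : B k x -> B l y -> exists2 m, B m x & B m y.
Proof.
move=> Ax Ay; exists (maxn k l); [apply: B_mono T _ _ _ _ Ax|apply: B_mono T _ _ _ _ Ay].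
  exact: leq_maxl.
exact: leq_maxr.
Qed.

Lemma tau_sqnorm x x' : adjoint_op dot x x' -> tau (x' \o x) = `|x Om| ^+ 2.
Proof. by move=> xx'; rewrite Hdot -(adjoint_sym xx'). Qed.

Lemma norm_adjoint k x x' : A k x -> A k x' -> adjoint_op dot x x' ->
  `|x' Om| = `|x Om|.
Proof.
move=> Ax Ax' xx'; apply/eqP; rewrite -(@eqrXn2 _ 2)//; apply/eqP.
by rewrite -(tau_sqnorm xx') -(tau_sqnorm (adjoint_sym xx')) (tau_cyclic T Ax Ax').
Qed.

(** |y x Om| = |x^* y^* Om| and |y^* Om| = |y Om| because the vector state
    is a trace; so y Om |-> y x Om is bounded by the norm of x^*. *)
Lemma right_mult k x : A k x -> exists2 rho : op H, bounded_op rho &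
  forall l y, A l y -> rho (y Om) = y (x Om).
Proof.
move=> Ax; have [x' Ax' xx'] := A_adjoint T Ax.
have [lx' [c c0 x'c]] := (bounded_opP x').1 (A_bounded T Ax').
pose G h k := exists l y, [/\ A l y, h = y Om & k = y (x Om)].
have [rho brho rhoG] : exists2 rho : op H, bounded_op rho & forall h k, G h k -> rho h = k.
  apply: (bounded_graph_extension c0).
  - move=> d _ _ _ _ [l [y [Ay -> ->]]] [m [z [Az -> ->]]].
    have [n Ayn Azn] := A_common Ay Az.
    exists n, (fun h => d *: y h + z h); split=> //.
    by have [_ + _] := subalgebra_A T n; apply.
  - move=> _ _ [l [y [Ay -> ->]]]; have [n Ayn Axn] := A_common Ay Ax.
    have [y' Ay' yy'] := A_adjoint T Ayn.
    have [x2 Ax2 xx2] := A_adjoint T Axn.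
    have -> : `|y (x Om)| = `|x2 (y' Om)|.
      have sA := subalgebra_A T n.
      rewrite -[x2 _]/((x2 \o y') Om) -[y _]/((y \o x) Om).
      apply/esym/norm_adjoint; first exact: subalgebra_comp sA Ayn Axn.
        exact: subalgebra_comp sA Ax2 Ay'.
      exact: adjoint_comp.
    have -> : x2 = x'.
      apply/funext => h; apply: (dot_inj (dot := dot)) => w.
      by rewrite (adjoint_sym xx') (adjoint_sym xx2).
    by rewrite -(norm_adjoint Ayn Ay' yy').
  - rewrite -(orbit_A_dense T); congr closure; apply/seteqP; split=> h.
      by move=> [k' [l [y [Ay -> _]]]]; exact: mem_orbit_A Ay.
    by move=> /orbit_AE[l [y [Ay ->]]]; exists (y (x Om)), l, y.
by exists rho => // l y Ay; apply: rhoG; exists l, y.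
Qed.

Lemma orbit_adjoint f g : bounded_op f -> bounded_op g ->
  (forall k x y, A k x -> A k y -> dot (f (x Om)) (y Om) = dot (x Om) (g (y Om))) ->
  adjoint_op dot f g.
Proof.
move=> bf bg fg; apply: (dense_adjoint Hdot (orbit_A_dense T) bf bg).
move=> _ _ /orbit_AE[k [x [Ax ->]]] /orbit_AE[l [y [Ay ->]]].
by have [m Amx Amy] := A_common Ax Ay; exact: fg Amx Amy.
Qed.

Lemma orbit_eq f f' g g' : adjoint_op dot f f' -> adjoint_op dot g g' ->
  (forall k x, A k x -> f (x Om) = g (x Om)) -> forall h, f h = g h.
Proof.
move=> ff' gg' fg; suff -> : f = g by [].
apply: (dense_adjoint_eq Hdot (orbit_A_dense T) ff' gg').
by move=> _ /orbit_AE[k [x [Ax ->]]]; exact: fg Ax.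
Qed.

Lemma right_mult_adjoint k x x' rho rho' : A k x -> A k x' -> adjoint_op dot x x' ->
  bounded_op rho -> bounded_op rho' ->
  (forall l y, A l y -> rho (y Om) = y (x Om)) ->
  (forall l y, A l y -> rho' (y Om) = y (x' Om)) -> adjoint_op dot rho rho'.
Proof.
move=> Ax Ax' xx' brho brho' rhoE rhoE'.
apply: orbit_adjoint => // l y z Ay Az.
rewrite (rhoE _ _ Ay) (rhoE' _ _ Az).
have [z' Az' zz'] := A_adjoint T Az.
rewrite -!(adjoint_sym zz') -xx'.
exact: (tau_cyclic T (subalgebra_comp (subalgebra_A T l) Az' Ay) Ax).
Qed.

Lemma right_mults : exists r r' : I -> op H,
  [/\ forall i, [/\ bounded_op (r i), bounded_op (r' i) & adjoint_op dot (r i) (r' i)],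
      forall i k x, A k x -> r i (x Om) = x (a i Om) &
      forall i k x, A k x -> r' i (x Om) = x (a' i Om)].
Proof.
have /choice[r rP] : forall i, exists r : op H,
    bounded_op r /\ forall k x, A k x -> r (x Om) = x (a i Om).
  move=> i; have [Aa _ _] := ft_a T i.
  by have [r br rE] := right_mult Aa; exists r.
have /choice[r' rP'] : forall i, exists r : op H,
    bounded_op r /\ forall k x, A k x -> r (x Om) = x (a' i Om).
  move=> i; have [_ Aa _] := ft_a T i.
  by have [r' br rE] := right_mult Aa; exists r'.
exists r, r'; split=> [i|i|i]; [|by case: (rP i)|by case: (rP' i)].
have [bri riE] := rP i; have [br'i r'iE] := rP' i; split=> //.
have [Aa Aa' aa'] := ft_a T i.
exact: right_mult_adjoint Aa Aa' aa' bri br'i riE r'iE.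
Qed.

(** * The projection onto the closure of N Om *)

(** E(f b) = tau(f) b for f in A_0: this is where the commuting squares enter
    the conditional expectation. *)
Lemma expects_mul_A0 f b k : A 0 f -> B k b ->
  expects dot Om UB (f \o b) (fun h => tau f *: b h).
Proof.
move=> Af Bb; split; first by exists k => //; exact: subalgebraZ (subalgebra_B T k) Bb.
move=> c [l _ Bc]; have [m Bbm Bcm] := B_common Bb Bc.
have [_ [c' Bc' cc']] := star_closed_B T Bcm.
have sB := subalgebra_B T m; have sA := subalgebra_A T m.
have Ab := B_sub_A T Bbm; have Ac' := B_sub_A T Bc'.
have Af' := A_mono T (leq0n m) Af.
have Bbc := subalgebra_comp sB Bbm Bc'.
rewrite dotZl -!(adjoint_sym cc') /=.
have := tau_cyclic T Ac' (subalgebra_comp sA Af' Ab); rewrite {1}/vec_trace /= => ->.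
rewrite -[LHS]/(tau (f \o (b \o c'))) (tau_mul Hdot T Af Bbc).
by rewrite (tau_cyclic T Ab Ac').
Qed.

Lemma expects_comb P c x y x' y' :
  (forall z w, P z -> P w -> P (fun h => c *: z h + w h)) ->
  expects dot Om P x y -> expects dot Om P x' y' ->
  expects dot Om P (fun h => c *: x h + x' h) (fun h => c *: y h + y' h).
Proof.
move=> Pl [Py xy] [Py' xy']; split; first exact: Pl.
by move=> d Pd; rewrite !dotPl xy// xy'.
Qed.

Lemma UB_comb c z w : UB z -> UB w -> UB (fun h => c *: z h + w h).
Proof.
move=> [k _ Bz] [l _ Bw]; have [m Bzm Bwm] := B_common Bz Bw.
by exists m => //; have [_ + _] := subalgebra_B T m; apply.
Qed.

Lemma expects_ex k x : A k x -> exists y, expects dot Om UB x y.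
Proof.
move=> Ax; have [b Bb ->] := A_expand T Ax.
exists (fun h => \sum_i tau (a i) *: b i h).
have aA i : A 0 (a i) by have [] := ft_a T i.
elim: (index_enum I) => [|i s IH].
  have -> : (fun h => \sum_(i <- [::]) a i (b i h)) = (fun=> 0).
    by apply/funext => h; rewrite big_nil.
  have -> : (fun h => \sum_(i <- [::]) tau (a i) *: b i h) = (fun=> 0).
    by apply/funext => h; rewrite big_nil.
  split=> [|c _]; last by rewrite !linear0l.
  by exists 0%N => //; exact: subalgebra0 (subalgebra_B T 0).
have := expects_comb (UB_comb 1) (expects_mul_A0 (aA i) (Bb i)) IH.
congr (expects _ _ _); apply/funext => h; by rewrite big_cons scale1r.
Qed.

Lemma vacuum_projection : exists p : op H,
  [/\ bounded_op p, adjoint_op dot p p &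
      forall k x y, A k x -> expects dot Om UB x y -> p (x Om) = y Om].
Proof.
pose G h k := exists l x y, [/\ A l x, expects dot Om UB x y, h = x Om & k = y Om].
have [p bp pG] : exists2 p : op H, bounded_op p & forall h k, G h k -> p h = k.
  apply: (bounded_graph_extension ler01).
  - move=> d _ _ _ _ [l [x [y [Ax xy -> ->]]]] [m [z [w [Az zw -> ->]]]].
    have [n Axn Azn] := A_common Ax Az.
    exists n, (fun h => d *: x h + z h), (fun h => d *: y h + w h); split=> //.
      by have [_ + _] := subalgebra_A T n; apply.
    exact: expects_comb (UB_comb d) xy zw.
  - move=> _ _ [l [x [y [Ax [By xy] -> ->]]]]; rewrite mul1r.
    have := xy y By; rewrite -Hdot => e2.
    have [->|y0] := eqVneq (`|y Om|) 0; first exact: normr_ge0.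
    rewrite -(@ler_pM2r _ `|y Om|) ?lt0r ?y0 ?normr_ge0// -expr2 -e2.
    rewrite -[leLHS]ger0_norm ?cauchy_schwarz//.
    by rewrite e2 exprn_ge0.
  - rewrite -(orbit_A_dense T); congr closure; apply/seteqP; split=> h.
      by move=> [k' [l [x [y [Ax _ -> _]]]]]; exact: mem_orbit_A Ax.
    move=> /orbit_AE[l [x [Ax ->]]]; have [y xy] := expects_ex Ax.
    by exists (y Om), l, x, y.
have pE k x y : A k x -> expects dot Om UB x y -> p (x Om) = y Om.
  by move=> Ax xy; apply: pG; exists k, x, y.
exists p; split=> //; apply: orbit_adjoint => // k x z Ax Az.
have [y xy] := expects_ex Ax; have [w zw] := expects_ex Az.
rewrite (pE _ _ _ Ax xy) (pE _ _ _ Az zw).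
rewrite dotC (zw.2 _ xy.1) -dotC; exact/esym/(xy.2 _ zw.1).
Qed.

End ConditionalExpectation.

(** * Relations between the projection and the right multiplications *)

Section RightMultiplications.
Context {R : realType} {H : completeNormedModType R[i]}.
Variable dot : {dot H for (@Num.conj R[i])}.
Hypothesis Hdot : norm_of_dot dot.
Local Notation C := R[i].
Variables (Om : H) (I J : finType) (a a' : I -> op H) (q q' : J -> op H).
Variables (A B : nat -> set (op H)) (e : nat -> op H) (lam : C).
Hypothesis T : framed_tower dot Om a a' q q' A B e lam.
Local Notation tau := (vec_trace dot Om).

Local Notation UA := (\bigcup_k A k).
Local Notation UB := (\bigcup_k B k).
Local Notation M := (weak_closure dot UA).
Local Notation N := (weak_closure dot UB).

(** r i and r' i are right multiplication by a i and its adjoint, and p is the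
    projection onto the closure of N Om. *)
Variables (r r' : I -> op H) (p : op H).
Hypothesis rP :
  forall i, [/\ bounded_op (r i), bounded_op (r' i) & adjoint_op dot (r i) (r' i)].
Hypothesis rE : forall i k x, A k x -> r i (x Om) = x (a i Om).
Hypothesis r'E : forall i k x, A k x -> r' i (x Om) = x (a' i Om).
Hypotheses (p_bounded : bounded_op p) (p_adjoint : adjoint_op dot p p).
Hypothesis pE : forall k x y, A k x -> expects dot Om UB x y -> p (x Om) = y Om.

Let r_bounded i : bounded_op (r i). Proof. by case: (rP i). Qed.
Let r'_bounded i : bounded_op (r' i). Proof. by case: (rP i). Qed.
Let r_adjoint i : adjoint_op dot (r i) (r' i). Proof. by case: (rP i). Qed.
Let r'_linear i : linear (r' i). Proof. exact/bounded_op_lin. Qed.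
Let p_linear : linear p. Proof. exact/bounded_op_lin. Qed.

Lemma UA_sub_M : UA `<=` M.
Proof.
by move=> x [k _ Ax]; apply: sub_weak_closure (A_bounded T Ax); exists k.
Qed.

Lemma UB_sub_N : UB `<=` N.
Proof.
move=> x [k _ Bx]; apply: sub_weak_closure (A_bounded T (B_sub_A T Bx)).
by exists k.
Qed.

Lemma N_sub_M : N `<=` M.
Proof.
by apply: weak_closure_mono => x [k _ Bx]; exists k => //; exact: B_sub_A T _ _ Bx.
Qed.

(** Left and right multiplications commute on x Om, and this passes to the weak
    closure. *)
Lemma right_mult_comm rho rho' v : adjoint_op dot rho rho' ->
  (forall k x, A k x -> rho (x Om) = x v) ->
  forall x, M x -> forall h, rho (x h) = x (rho h).
Proof.
move=> rr' rhoE x Mx h.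
suff : rho \o x = x \o rho by move=> /(congr1 (fun f => f h)).
apply: (weak_closure_commute rr' _ Mx) => y [k _ Ay]; apply/funext => {}h.
have [y' Ay' yy'] := A_adjoint T Ay.
apply: (orbit_eq Hdot T (adjoint_comp rr' yy') (adjoint_comp yy' rr')) => m x' Ax'.
have [n Ayn Axn] := A_common T Ay Ax'.
rewrite /= (rhoE _ _ Axn).
by rewrite -[y (x' Om)]/((y \o x') Om) (rhoE n)//; exact: subalgebra_comp (subalgebra_A T n) Ayn Axn.
Qed.

Lemma r_comm i x h : M x -> r i (x h) = x (r i h).
Proof. by move=> Mx; apply: (right_mult_comm (r_adjoint i) _ Mx) => k y; exact: rE. Qed.

Lemma r'_comm i x h : M x -> r' i (x h) = x (r' i h).
Proof.
by move=> Mx; apply: (right_mult_comm (adjoint_sym (r_adjoint i)) _ Mx) => k y; exact: r'E.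
Qed.

Lemma p_comm x h : N x -> p (x h) = x (p h).
Proof.
move=> Nx; suff : p \o x = x \o p by move=> /(congr1 (fun f => f h)).
apply: (weak_closure_commute p_adjoint _ Nx) => y [k _ By]; apply/funext => {}h.
have [_ [y' By' yy']] := star_closed_B T By; have Ay := B_sub_A T By.
apply: (orbit_eq Hdot T (adjoint_comp p_adjoint yy') (adjoint_comp yy' p_adjoint)).
move=> l w Aw /=; have [z [Bz wz]] := expects_ex Hdot T Aw.
rewrite (pE Aw (conj Bz wz)).
have [n Ayn Awn] := A_common T Ay Aw.
rewrite -[y (w Om)]/((y \o w) Om) (pE (y := y \o z) (subalgebra_comp (subalgebra_A T n) Ayn Awn))//.
case: Bz => m _ Bzm; split.
  have [m2 Byo Bzo] := B_common T By Bzm.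
  by exists m2 => //; exact: subalgebra_comp (subalgebra_B T m2) Byo Bzo.
move=> c [m2 _ Bc]; rewrite /= !yy' -[y' (c Om)]/((y' \o c) Om) wz//.
have [m3 Bz2 Bco] := B_common T By' Bc.
by exists m3 => //; exact: subalgebra_comp (subalgebra_B T m3) Bz2 Bco.
Qed.

Lemma p_fix k y : B k y -> p (y Om) = y Om.
Proof.
move=> By; apply: pE (B_sub_A T By) _; split=> //; by exists k.
Qed.

Lemma p_A0 f k y : A 0 f -> B k y -> p (f (y Om)) = tau f *: y Om.
Proof.
move=> Af By; have Afk := A_mono T (leq0n k) Af.
have := pE (subalgebra_comp (subalgebra_A T k) Afk (B_sub_A T By)) (expects_mul_A0 Hdot T Af By).
by [].
Qed.

Lemma p_idem h : p (p h) = p h.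
Proof.
apply: (orbit_eq Hdot T (adjoint_comp p_adjoint p_adjoint) p_adjoint) => k x Ax.
have [y xy] := expects_ex Hdot T Ax; rewrite /= (pE Ax xy).
by have [[l _ By] _] := xy; exact: p_fix By.
Qed.

Lemma p_compress_A0 f h : A 0 f -> p (f (p h)) = tau f *: p h.
Proof.
move=> Af; have [f' Af' ff'] := A_adjoint T Af.
have adj : adjoint_op dot (fun h => tau f *: p h + 0) (fun h => (tau f)^* *: p h + 0).
  exact: adjoint_comb p_adjoint (adjoint0 dot).
have := orbit_eq Hdot T (adjoint_comp p_adjoint (adjoint_comp ff' p_adjoint)) adj.
move=> /(_ _ h)/=; rewrite addr0; apply=> k x Ax; rewrite addr0.
have [y xy] := expects_ex Hdot T Ax; rewrite /= (pE Ax xy).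
by have [[l _ By] _] := xy; exact: p_A0 By.
Qed.

(** Completeness of the orthonormal basis of A_0, carried to H by A_k = B_k A_0. *)
Lemma rpr_complete h : \sum_i r' i (p (r i h)) = h.
Proof.
have adj : adjoint_op dot (fun h => \sum_i r' i (p (r i h))) (fun h => \sum_i r' i (p (r i h))).
  apply: adjoint_sum => i.
  exact: (adjoint_comp (adjoint_sym (r_adjoint i)) (adjoint_comp p_adjoint (r_adjoint i))).
apply: (orbit_eq Hdot T adj (adjoint_id dot)) => k x Ax /=.
have [b Bb bE] := A_expand_right T Ax.
have aA i : A 0 (a i) by have [] := ft_a T i.
have aA' i : A 0 (a' i) by have [] := ft_a T i.
have term i l : p (b l (a' l (a i Om))) = (l == i)%:R *: b l Om.
  rewrite p_comm; last by apply: UB_sub_N; exists k.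
  have A1 : A 0 (a' l \o a i) by exact: subalgebra_comp (ft_subA0 T) _ _.
  have B1 : B 0 idfun by case: (subalgebra_B T 0).
  have := p_A0 A1 B1; rewrite /= (ft_on_a T) => ->.
  by rewrite linZ//; exact: (A_linear T (B_sub_A T (Bb l))).
rewrite [in RHS]bE; apply: eq_bigr => i _.
rewrite (rE _ Ax) bE (lin_sum _ _ _ p_linear).
under eq_bigr => l _ do rewrite term.
rewrite (bigD1 i)//= big1 => [|l li]; last by rewrite (negbTE li) scale0r.
by rewrite eqxx scale1r addr0 (r'E _ (B_sub_A T (Bb i))).
Qed.

Lemma prr_compress i h : p (r i (r' i (p h))) = p h.
Proof.
have [Aa Aa' aa'] := ft_a T i.
have adj := adjoint_comp (r_adjoint i) (adjoint_sym (r_adjoint i)).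
have := orbit_eq Hdot T (adjoint_comp p_adjoint (adjoint_comp adj p_adjoint)) p_adjoint.
move=> /(_ _ h); apply => k x Ax.
have [y xy] := expects_ex Hdot T Ax; rewrite /= (pE Ax xy).
have [[l _ By] _] := xy; have Ay := B_sub_A T By.
have Aal := A_mono T (leq0n l) Aa; have Aal' := A_mono T (leq0n l) Aa'.
have sA := subalgebra_A T l.
rewrite (r'E _ Ay) -[y _]/((y \o a' i) Om) (rE _ (subalgebra_comp sA Ay Aal')).
rewrite /= p_comm; last by apply: UB_sub_N; exists l.
have A1 : A 0 (a' i \o a i) by exact: subalgebra_comp (ft_subA0 T) _ _.
have B1 : B 0 idfun by case: (subalgebra_B T 0).
have := p_A0 A1 B1; rewrite /= (ft_on_a T) eqxx scale1r => ->.
by [].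
Qed.

(** * The conditional expectation *)

(** H is the orthogonal sum of the subspaces r'_i p H, each a copy of the
    closure of N Om as an N-module; the expectation of x acts on each copy as
    p x p does on the closure of N Om. Being a finite sum of
    compressions it is weakly continuous, so its values on M lie in N because
    its values on the union of the A_k lie in the union of the B_k. *)
Definition framed_expectation (x : op H) : op H :=
  fun h => \sum_i r' i (p (x (p (r i h)))).
Local Notation E := framed_expectation.

Lemma framed_expectation_A0 f h : A 0 f -> E f h = tau f *: h.
Proof.
move=> Af; rewrite -[in RHS](rpr_complete h) scaler_sumr; apply: eq_bigr => i _.
by rewrite p_compress_A0// linZ.
Qed.

Lemma framed_expectation_bimod x y z h : M y -> N x -> N z ->
  E (x \o y \o z) h = x (E y (z h)).
Proof.
move=> My Nx Nz; have Mx := N_sub_M Nx; have Mz := N_sub_M Nz.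
rewrite [RHS]lin_sum; last by case: Nx => -[].
by apply: eq_bigr => i _ /=; rewrite -(r'_comm _ _ Mx) -(p_comm _ Nx) -(p_comm _ Nz) -(r_comm _ _ Mz).
Qed.

Lemma framed_expectation_N x h : N x -> E x h = x h.
Proof.
move=> Nx; have Mx := N_sub_M Nx.
rewrite -[in LHS](rpr_complete h) /E -[in RHS](rpr_complete h).
rewrite [RHS]lin_sum; last by case: Nx => -[].
rewrite rpr_complete; apply: eq_bigr => i _.
by rewrite (p_comm _ Nx) p_idem (r'_comm _ _ Mx).
Qed.

Lemma UB_in_N k b : B k b -> N b.
Proof. by move=> Bb; apply: UB_sub_N; exists k. Qed.

Lemma framed_expectation_UA x : UA x -> UB (E x).
Proof.
move=> [k _ Ax]; have [b Bb ->] := A_expand T Ax; exists k => //.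
have aA i : A 0 (a i) by have [] := ft_a T i.
have -> : E (fun h => \sum_i a i (b i h)) = (fun h => \sum_i tau (a i) *: b i h).
  apply/funext => h; rewrite /E.
  under eq_bigr => i _ do rewrite (lin_sum _ _ _ p_linear) (lin_sum _ _ _ (r'_linear i)).
  rewrite exchange_big /=; apply: eq_bigr => l _.
  rewrite -(framed_expectation_A0 _ (aA l)) /E; apply: eq_bigr => i _.
  by rewrite -(p_comm _ (UB_in_N (Bb l))) (r_comm _ _ (N_sub_M (UB_in_N (Bb l)))).
apply: (subalgebra_sum _ (subalgebra_B T k)) => i.
exact: subalgebraZ (subalgebra_B T k) (Bb i).
Qed.

Lemma framed_expectation_M x : M x -> N (E x).
Proof.
pose V i := r' i \o p; pose W i := p \o r i.
have VW i : adjoint_op dot (V i) (W i).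
  exact: adjoint_comp (adjoint_sym (r_adjoint i)) p_adjoint.
apply: (weak_closure_compress VW) => [i|i|y /framed_expectation_UA//].
  exact: bounded_op_comp.
exact: bounded_op_comp.
Qed.

(** p r_i Om = tau(a_i) Om, and the |tau(a_i)|^2 add up to |Om|^2 = 1. *)
Lemma framed_expectation_trace x : M x -> tau (E x) = tau x.
Proof.
move=> Mx; have lx : linear x by case: Mx => -[].
have A1 : A 0 idfun by case: (subalgebra_A T 0).
have B1 : B 0 idfun by case: (subalgebra_B T 0).
have prOm i : p (r i Om) = tau (a i) *: Om.
  have [Aa _ _] := ft_a T i.
  have -> : r i Om = a i Om by exact: (rE i A1).
  exact: (p_A0 Aa B1).
have sum1 : \sum_i tau (a i) * (tau (a i))^* = 1.
  transitivity (dot Om Om); last first.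
    by rewrite -Hdot; have [-> _ _] := ft_gns T; rewrite expr1n.
  have -> : dot Om Om = dot (\sum_i r' i (p (r i Om))) Om by rewrite rpr_complete.
  rewrite dot_suml; apply: eq_bigr => i _.
  have -> : dot (r' i (p (r i Om))) Om = dot (p (r i Om)) (p (r i Om)).
    by rewrite (adjoint_sym (r_adjoint i)) -p_adjoint p_idem.
  rewrite prOm dotZl dotZr.
  by rewrite -Hdot; have [-> _ _] := ft_gns T; rewrite expr1n mulr1.
rewrite /vec_trace dot_suml -[RHS]mul1r -sum1 mulr_suml; apply: eq_bigr => i _.
rewrite (adjoint_sym (r_adjoint i)) p_adjoint prOm (linZ _ _ lx) dotZl dotZr.
by rewrite mulrA.
Qed.

Lemma framed_cond_exp : is_cond_exp dot Om M N E.
Proof.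
split=> [c x y _ _|x Mx|x Nx|x y z Nx My Nz|x _ xpos h].
- apply/funext => h; rewrite -[RHS]/(c *: E x h + E y h) scaler_sumr -big_split.
  by apply: eq_bigr => i _; rewrite p_linear r'_linear.
- by split; [exact: framed_expectation_M|exact: framed_expectation_trace].
- by apply/funext => h; exact: framed_expectation_N.
- by apply/funext => h; exact: framed_expectation_bimod.
rewrite dot_suml sumr_ge0// => i _.
by rewrite (adjoint_sym (r_adjoint i)) p_adjoint xpos.
Qed.

(** * The index *)

Lemma commutant_subalgebra (S : set (op H)) :
  (forall x, S x -> linear x) -> subalgebra (commutant S).
Proof.
move=> Sl; split=> [|c x y [bx cx] [by_ cy]|x y [bx cx] [by_ cy]].
- by split=> //; exact: bounded_op_id.
- split; first exact: bounded_op_comb.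
  move=> z Sz; apply/funext => h /=; rewrite (Sl _ Sz).
  have /(congr1 (fun f => f h))/= -> := cx z Sz.
  by have /(congr1 (fun f => f h))/= -> := cy z Sz.
split; first exact: bounded_op_comp.
move=> z Sz; apply/funext => h /=.
have /(congr1 (fun f => f h))/= -> := cy z Sz.
by have /(congr1 (fun f => f (y h)))/= -> := cx z Sz.
Qed.

Let N_linear x : N x -> linear x. Proof. by case=> -[]. Qed.

Lemma p_commutant : commutant N p.
Proof. by split=> // y Ny; apply/funext => h /=; rewrite p_comm. Qed.

Lemma r_commutant i : commutant N (r i) /\ commutant N (r' i).
Proof.
split; split=> // y /N_sub_M My; apply/funext => h /=; [exact: r_comm|exact: r'_comm].
Qed.

(** The projections r_i^* p r_i add up to 1 and are all equivalent to p in the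
    commutant of N, so p has trace 1 / #|I| there. *)
Lemma commutant_trace_p tau' : tracial_state dot (commutant N) tau' ->
  tau' p * #|I|%:R = 1.
Proof.
move=> [tl t1 tc _]; have sN := commutant_subalgebra N_linear.
have [c1 cl cc] := sN.
pose F i := r' i \o p \o r i.
have cF i : commutant N (F i).
  by have [? ?] := r_commutant i; apply/cc => //; apply/cc => //; exact: p_commutant.
have tF i : tau' (F i) = tau' p.
  have [cr cr'] := r_commutant i; have cp := p_commutant.
  have -> : F i = (r' i \o p) \o (p \o r i) by apply/funext => h; rewrite /= p_idem.
  rewrite tc; [|exact: cc|exact: cc].
  by congr tau'; apply/funext => h /=; rewrite prr_compress.
have t0 : tau' (fun=> 0) = 0.
  have -> : (fun=> 0) = (fun h : H => -1 *: h + h).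
    by apply/funext => h; rewrite scaleN1r addNr.
  have := tl (-1) _ _ c1 c1; rewrite -[X in X -> _]/(tau' (fun h => -1 *: h + h) = _) => ->.
  by rewrite scaleN1r addNr.
have tsum (s : seq I) : tau' (fun h => \sum_(i <- s) F i h) = \sum_(i <- s) tau' (F i).
  elim: s => [|i s IH].
    rewrite big_nil -[RHS]t0; congr tau'; apply/funext => h; by rewrite big_nil.
  rewrite big_cons -IH.
  have := tl 1 _ _ (cF i) (subalgebra_sum s sN cF); rewrite scale1r => <-.
  by congr tau'; apply/funext => h; rewrite big_cons scale1r.
rewrite -[RHS]t1; transitivity (tau' (fun h => \sum_i F i h)).
  rewrite tsum; under eq_bigr => i _ do rewrite tF.
  by rewrite sumr_const mulr_natr.
by congr tau'; apply/funext => h; exact: rpr_complete.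
Qed.

(** The vector Om is cyclic for the commutant of N, which contains the right
    multiplications, and p projects onto the closure of N Om. *)
Lemma framed_coupling_constant c : coupling_constant dot N c -> c = #|I|%:R.
Proof.
move=> [tau1 [tau' [[_ t1 _ _] tr' /(_ Om idfun p)]]].
have tp := commutant_trace_p tr'.
rewrite t1 => h; suff E1 : 1 / tau' p = c%:C%C.
  have p0 : tau' p != 0.
    by apply/eqP => p0; move: tp; rewrite p0 mul0r => /eqP; rewrite eq_sym oner_eq0.
  have : c%:C%C = (#|I|%:R)%:C%C.
    by rewrite -E1 div1r; apply: (mulfI p0); rewrite mulfV// rmorph_nat tp.
  by case.
apply: h => //.
- exact: Om_neq0 T.
- exact: bounded_op_id.
- move=> h _; split; last by move=> v _; rewrite subrr linear0l.
  have : closure (orbit_A Om A) h by rewrite (orbit_A_dense T).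
  apply: closure_subset => _ [x [k _ Ax] <-].
  have [rho brho rhoE] := right_mult Hdot T Ax.
  have A1 : A 0 idfun by case: (subalgebra_A T 0).
  exists rho; last by rewrite -[Om in LHS]/(idfun Om) (rhoE _ _ A1).
  have [x' Ax' xx'] := A_adjoint T Ax.
  have [rho' brho' rhoE'] := right_mult Hdot T Ax'.
  have rr' := right_mult_adjoint Hdot T Ax Ax' xx' brho brho' rhoE rhoE'.
  split=> // y /N_sub_M My; apply/funext => g /=.
  by rewrite (right_mult_comm rr' (fun l => rhoE l) My).
move=> h _; split.
  apply/closure_normP => eps eps0.
  have [_ [c0 c00 pc]] := (bounded_opP p).1 p_bounded.
  have c1 : 0 < c0 + 1 by rewrite ltr_wpDl.
  have : closure (orbit_A Om A) h by rewrite (orbit_A_dense T).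
  move=> /closure_normP /(_ (eps / (c0 + 1)))[|v /orbit_AE[k [x [Ax ->]]] hx].
    by rewrite divr_gt0.
  have [y xy] := expects_ex Hdot T Ax; have [UBy _] := xy.
  exists (y Om); first by exists y => //; exact: UB_sub_N.
  rewrite -(pE Ax xy) -(linB _ _ p_linear) (le_lt_trans (pc _))//.
  apply: (@le_lt_trans _ _ (c0 * (eps / (c0 + 1)))); first by rewrite ler_wpM2l// ltW.
  by rewrite mulrCA gtr_pMr// ltr_pdivrMr// mul1r ltrDl.
have orth y : N y -> dot (h - p h) (y Om) = 0.
  move=> Ny; have B1 : B 0 idfun by case: (subalgebra_B T 0).
  have -> : y Om = p (y Om) by rewrite p_comm// (p_fix B1).
  by rewrite -p_adjoint (linB _ _ p_linear) p_idem subrr linear0l.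
move=> v /closure_normP clv; apply/eqP; rewrite -normr_eq0 eq_le normr_ge0 andbT.
apply/ler_addgt0Pr => eps eps0; rewrite add0r.
have n1 : 0 < `|h - p h| + 1 by rewrite ltr_wpDl.
have [|_ [y Ny <-] vy] := clv (eps / (`|h - p h| + 1)); first by rewrite divr_gt0.
rewrite -(subr0 (dot _ v)) -(orth y Ny) -dotBr (le_trans (cauchy_schwarz Hdot _ _))//.
apply: (@le_trans _ _ (`|h - p h| * (eps / (`|h - p h| + 1)))).
  by rewrite ler_wpM2l// ltW.
by rewrite mulrCA ler_piMr ?ltW// ltr_pdivrMr// mul1r ltrDl.
Qed.

End RightMultiplications.

(** * Projections with scalar expectation *)

Section ScalarExpectations.
Context {R : realType} {H : completeNormedModType R[i]}.
Variable dot : {dot H for (@Num.conj R[i])}.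
Hypothesis Hdot : norm_of_dot dot.
Local Notation C := R[i].
Variables (Om : H) (I J : finType) (a a' : I -> op H) (q q' : J -> op H).
Variables (A B : nat -> set (op H)) (e : nat -> op H) (lam : C).
Hypothesis T : framed_tower dot Om a a' q q' A B e lam.
Local Notation tau := (vec_trace dot Om).

Local Notation M := (weak_closure dot (\bigcup_k A k)).
Local Notation N := (weak_closure dot (\bigcup_k B k)).

(** With W_i W_j^* matrix units of B_k, sum_ij W_i x_ij W_j^* is a projection
    when (x_ij) is one over A_0, and N-bilinearity of the expectation together
    with E = tau on A_0 computes its expectation entrywise. *)
Lemma frame_Lambda k (L : finType) (W W' : L -> op H) (eps : op H)
    (x : L -> L -> op H) (alpha : R) :
  matrix_frame dot A B k W W' eps ->
  (forall i j, A 0 (x i j)) -> (forall i j, adjoint_op dot (x i j) (x j i)) ->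
  (forall i j h, \sum_l x i l (x l j h) = x i j h) ->
  (forall i j, tau (x i j) = (i == j)%:R * alpha%:C%C) ->
  0 <= alpha <= 1 -> Lambda dot Om M N alpha.
Proof.
move=> [WB WW We epsA Wc] Ax xadj xx taux alpha01; split=> //.
have [r [r' [rP rE r'E]]] := right_mults Hdot T.
have [p [bp ap pE]] := vacuum_projection Hdot T.
pose E := framed_expectation r r' p.
exists E; split; first exact: (framed_cond_exp Hdot T rP rE r'E bp ap pE).
have NB b : B k b -> N b by move=> Bb; apply: (UB_sub_N T); exists k.
pose P : op H := fun h => \sum_i \sum_j W i (x i j (W' j h)).
have Wl i : linear (W i) by have [/(B_sub_A T)/(A_linear T)] := WB i.
have Wl' i : linear (W' i) by have [_ /(B_sub_A T)/(A_linear T)] := WB i.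
have xl i j : linear (x i j) by exact: A_linear T _ _ (Ax i j).
have sA := subalgebra_A T k.
have At i j : A k (W i \o x i j \o W' j).
  have [/(B_sub_A T) AW _ _] := WB i; have [_ /(B_sub_A T) AW' _] := WB j.
  apply: (subalgebra_comp sA _ AW'); apply: (subalgebra_comp sA AW).
  exact: (A_mono T (leq0n k) (Ax i j)).
have AP : A k P.
  apply: (subalgebra_sum _ sA) => i; apply: (subalgebra_sum _ sA) => j.
  exact: At.
have MP : M P by apply: (UA_sub_M T); exists k.
exists P; split=> //; last first.
  apply/funext => h; rewrite -[in RHS](Wc h) scaler_sumr.
  have -> : E P h = \sum_i \sum_j E (W i \o x i j \o W' j) h.
    rewrite /E /framed_expectation /P.
    under eq_bigr => l _.
      rewrite (lin_sum _ _ _ (bounded_op_lin bp)).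
      rewrite lin_sum; last by case: (rP l) => _ /bounded_op_lin.
      under eq_bigr => i _.
        rewrite (lin_sum _ _ _ (bounded_op_lin bp)).
        rewrite lin_sum; last by case: (rP l) => _ /bounded_op_lin.
        over.
      over.
    rewrite exchange_big /=; apply: eq_bigr => i _.
    by rewrite exchange_big.
  apply: eq_bigr => i _.
  have Eij j : E (W i \o x i j \o W' j) h = ((i == j)%:R * alpha%:C%C) *: W i (W' j h).
    have [BW _ _] := WB i; have [_ BW' _] := WB j.
    rewrite /E (framed_expectation_bimod Hdot T rP rE r'E ap pE); last 3 first.
    - by apply: (UA_sub_M T); exists 0%N.
    - exact: NB.
    - exact: NB.
    rewrite (framed_expectation_A0 Hdot T rP rE r'E bp ap pE)// linZ//.
    by rewrite taux.
  under eq_bigr => j _ do rewrite Eij.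
  rewrite (bigD1 i)//= big1 => [|j ji].
    by rewrite eqxx mul1r addr0.
  by rewrite eq_sym (negbTE ji) mul0r scale0r.
split; first exact: A_bounded T _ _ AP.
  move=> u v; rewrite dot_suml dot_sumr.
  under eq_bigr => i _ do rewrite dot_suml.
  under [RHS]eq_bigr => i _ do rewrite dot_sumr.
  rewrite exchange_big /=; apply: eq_bigr => i _; apply: eq_bigr => j _.
  have [_ _ WWi] := WB i; have [_ _ WWj] := WB j.
  by rewrite WWj xadj (adjoint_sym WWi).
apply/funext => h; rewrite /P /=; apply: eq_bigr => i _.
transitivity (\sum_j \sum_l W i (x i j (x j l (W' l h)))); last first.
  rewrite exchange_big /=; apply: eq_bigr => l _.
  by rewrite -(lin_sum _ _ _ (Wl i)) xx.
apply: eq_bigr => j _.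
have -> : W' j (\sum_i0 \sum_j0 W i0 (x i0 j0 (W' j0 h))) = \sum_l eps (x j l (W' l h)).
  rewrite (lin_sum _ _ _ (Wl' j)) [LHS](bigD1 j)//= [X in _ + X]big1 ?addr0 => [|l lj].
    rewrite (lin_sum _ _ _ (Wl' j)); apply: eq_bigr => l _.
    by rewrite WW eqxx scale1r.
  rewrite (lin_sum _ _ _ (Wl' j)) big1// => l' _.
  by rewrite WW eq_sym (negbTE lj) scale0r.
rewrite (lin_sum _ _ _ (xl i j)) (lin_sum _ _ _ (Wl i)).
by apply: eq_bigr => l _; rewrite -(epsA _ _ (Ax i j)) We.
Qed.

(** Take x = sum_s P_s (x) g_s: it is a projection because the g_s are
    orthogonal, and tau(g_s) = 1/m turns sum P_s = beta into (id (x) tau) x = beta / m. *)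
Lemma projections_Lambda (m d K : nat) (g : 'I_m -> op H) (P : 'I_m -> 'M[R]_d)
    (beta : R) :
  d = (#|J| ^ K.+1)%N ->
  (forall s, A 0 (g s) /\ adjoint_op dot (g s) (g s)) ->
  (forall s s' h, g s (g s' h) = (s == s')%:R *: g s h) ->
  (forall s, tau (g s) = m%:R^-1) ->
  (forall s, (P s)^T = P s /\ P s *m P s = P s) ->
  \sum_s P s = beta%:M -> 0 <= beta / m%:R <= 1 ->
  Lambda dot Om M N (beta / m%:R).
Proof.
move=> dE Ag gg tg PP sumP beta01.
have [L [W [W' [eps [fr cardL]]]]] := matrix_frames Hdot T K.
have dL : #|L| = d by rewrite cardL dE.
pose rk (i : L) : 'I_d := cast_ord dL (enum_rank i).
have rk_bij : bijective rk.
  exists (fun i => enum_val (cast_ord (esym dL) i)) => i; rewrite /rk.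
    by rewrite cast_ordK enum_rankK.
  by rewrite enum_valK cast_ordKV.
have rk_inj := bij_inj rk_bij.
pose x (i j : L) : op H := fun h => \sum_s (P s (rk i) (rk j))%:C%C *: g s h.
have gl s : linear (g s) by have [/(A_linear T)] := Ag s.
apply: (frame_Lambda fr (x := x)) => // [i j|i j|i j h|i j].
- apply: (subalgebra_sum _ (subalgebra_A T 0)) => s.
  by apply: subalgebraZ (subalgebra_A T 0) _; case: (Ag s).
- apply: adjoint_sum => s u v; have [PT _] := PP s; have [_ gs] := Ag s.
  rewrite dotZl dotZr gs; congr (_ * _).
  by rewrite -[in LHS]PT mxE [(_)^*]conjc_real.
- have xx l : x i l (x l j h) =
      \sum_s ((P s (rk i) (rk l))%:C%C * (P s (rk l) (rk j))%:C%C) *: g s h.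
    apply: eq_bigr => s _; rewrite (lin_sum _ _ _ (gl s)) (bigD1 s)//= big1 => [|s' ss'].
      by rewrite addr0 (linZ _ _ (gl s)) gg eqxx scale1r scalerA.
    by rewrite (linZ _ _ (gl s)) gg eq_sym (negbTE ss') scale0r scaler0.
  under eq_bigr => l _ do rewrite xx.
  rewrite exchange_big /=; apply: eq_bigr => s _; rewrite -scaler_suml.
  congr (_ *: _); have [_ PPs] := PP s.
  rewrite -[in RHS]PPs mxE (reindex rk) /=; last exact: onW_bij.
  by rewrite rmorph_sum /=; apply: eq_bigr => l _; rewrite rmorphM.
- rewrite tau_sum; under eq_bigr => s _ do rewrite tauZ tg.
  rewrite -mulr_suml -rmorph_sum /= -summxE sumP mxE (inj_eq rk_inj).
  case: (i == j); last by rewrite mulr0n rmorph0 !mul0r.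
  by rewrite mulr1n mul1r rmorphM /= fmorphV /= rmorph_nat.
Qed.

End ScalarExpectations.

(** * Scalar sums of projections *)

Section SumsOfProjections.
Context {R : rcfType}.

Definition orth_projection d (P : 'M[R]_d) := P^T = P /\ P *m P = P.

(** A diagonal matrix with entries 1 + c_i is a sum of two projections when
    the deviations c_i cancel in pairs: each pair gives the two rank one
    projections of slope c, and an unpaired entry is 0 or 1. *)
Lemma two_projections d (sigma : 'I_d -> 'I_d) (c : 'I_d -> R) :
  involutive sigma ->
  (forall i, sigma i = i -> c i = 0 \/ c i = -1) ->
  (forall i, sigma i != i -> c (sigma i) = - c i) ->
  (forall i, `|c i| <= 1) ->
  exists P Q : 'M[R]_d, [/\ orth_projection P, orth_projection Q &
    P + Q = \matrix_(i, j) ((i == j)%:R * (1 + c i))].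
Proof.
move=> sK cfix cpair c1.
pose s i : R := Num.sqrt (1 - c i ^+ 2).
have s2 i : s i ^+ 2 = 1 - c i ^+ 2.
  by rewrite sqr_sqrtr// subr_ge0 -real_normK ?num_real// expr_le1.
have ss i : sigma i != i -> s (sigma i) = s i.
  by move=> si; rewrite /s cpair// sqrrN.
have sN i : sigma i != i -> sigma (sigma i) != sigma i by rewrite sK eq_sym.
pose Pm (b : bool) : 'M[R]_d := \matrix_(i, j)
  if sigma i == i then (i == j)%:R * (b%:R * (1 + c i))
  else (i == j)%:R * ((1 + c i) / 2) + (sigma i == j)%:R * ((-1) ^+ b * (s i / 2)).
have Pfix b i l : sigma i = i -> Pm b i l = (i == l)%:R * (b%:R * (1 + c i)).
  by move=> si; rewrite mxE si eqxx.
have Ppair b i l : sigma i != i -> Pm b i l =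
    (i == l)%:R * ((1 + c i) / 2) + (sigma i == l)%:R * ((-1) ^+ b * (s i / 2)).
  by move=> si; rewrite mxE (negbTE si).
have Pproj b : orth_projection (Pm b).
  split; apply/matrixP => i j.
    rewrite mxE; have [si|si] := eqVneq (sigma i) i; have [sj|sj] := eqVneq (sigma j) j.
    - by rewrite !Pfix// eq_sym; case: eqP => [->|]; rewrite ?mul0r.
    - rewrite (Pfix _ i j si) (Ppair _ j i sj); case: eqVneq => [ji|ji]; first by move: sj; rewrite ji si eqxx.
      rewrite !mul0r add0r; case: eqVneq => [sji|]; last by rewrite mul0r.
      by move: si; rewrite -sji sK => ji'; rewrite -sji -ji' eqxx in ji.
    - rewrite (Ppair _ i j si) (Pfix _ j i sj); case: eqVneq => [ji|ji]; first by move: si; rewrite -ji sj eqxx.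
      rewrite !mul0r add0r; case: eqVneq => [sji|]; last by rewrite mul0r.
      by move: sj; rewrite -sji sK => ji'; rewrite -ji' eqxx in si.
    - rewrite !Ppair//; rewrite [j == i]eq_sym; congr (_ + _).
        by case: eqP => [->//|]; rewrite !mul0r.
      have -> : (sigma j == i) = (sigma i == j) by rewrite -(inj_eq (inv_inj sK)) sK eq_sym.
      by case: eqP => [<-|]; rewrite ?mul0r// ss.
  rewrite mxE; have [si|si] := eqVneq (sigma i) i.
    rewrite (bigD1 i)//= big1 ?addr0 => [|l li].
      rewrite !Pfix// eqxx mul1r mulrCA; congr (_ * _).
      by case: (cfix i si) => ->; case: b; rewrite /=; ring.
    by rewrite Pfix// eq_sym (negbTE li) !mul0r.
  rewrite (bigD1 i)//= (bigD1 (sigma i))//= big1 ?addr0 => [|l /andP[li lsi]]; last first.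
    by rewrite (Ppair _ i l)// eq_sym (negbTE li) eq_sym (negbTE lsi) !mul0r addr0 mul0r.
  have si' : (i == sigma i) = false by rewrite eq_sym (negbTE si).
  rewrite !(Ppair _ i)// (Ppair _ (sigma i)) ?sN// sK !eqxx (negbTE si) si'.
  rewrite cpair// ss//.
  have bb : (-1) ^+ b * (-1) ^+ b = 1 :> R by rewrite -signr_addb addbb.
  set u := (i == j)%:R; set v := (sigma i == j)%:R; set z := (-1) ^+ b in bb *.
  have -> : ((1 : R) * ((1 + c i) / 2) + 0 * (z * (s i / 2))) *
     (u * ((1 + c i) / 2) + v * (z * (s i / 2))) +
     (0 * ((1 + c i) / 2) + 1 * (z * (s i / 2))) *
     (v * ((1 + - c i) / 2) + u * (z * (s i / 2))) =
     u * ((1 + c i) ^+ 2 + (z * z) * s i ^+ 2) / 4 + v * (z * (s i / 2)) by field.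
  by rewrite bb s2; field.
exists (Pm true), (Pm false); split => //.
apply/matrixP => i j; rewrite mxE [RHS]mxE.
have [si|si] := eqVneq (sigma i) i; first by rewrite !Pfix//= mul0r mulr0 addr0 mul1r.
by rewrite !Ppair//=; field.
Qed.

(** The deviations 0, -2/d, 2/d, -4/d, 4/d, ... cancel within the pairs
    (2s-1, 2s), and after the change of c into -1/d - c they cancel within the
    pairs (2s, 2s+1); the chain starts at 0 and stops when it reaches -1. The
    bit b selects between the two pairings. *)
Lemma chain_projections d (b : bool) : (0 < d)%N ->
  exists P Q : 'M[R]_d, [/\ orth_projection P, orth_projection Q &
    P + Q = \matrix_(i, j) ((i == j)%:R *
      (1 + (if odd i (+) b then - (i.+1%:R / d%:R) else i%:R / d%:R)))].
Proof.
move=> d0; have dR : (0 : R) < d%:R by rewrite ltr0n.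
pose up (i : nat) := odd i (+) b.
pose f (i : nat) := if up i then (if (i.+1 < d)%N then i.+1 else i) else i.-1.
have fd (i : 'I_d) : (f i < d)%N.
  by rewrite /f; case: (up i); [case: ifP => //|apply: leq_ltn_trans (leq_pred _) _].
pose c (i : 'I_d) : R := if up i then - (i.+1%:R / d%:R) else i%:R / d%:R.
have upS i : up i.+1 = ~~ up i by rewrite /up /= addNb.
apply: (@two_projections d (fun i => Ordinal (fd i)) c).
- move=> i; apply/val_inj; rewrite /= /f; case: (boolP (up i)) => [ui|ui].
    by case: (boolP (i.+1 < d)%N) => [id|/negbTE id]; rewrite ?upS ui ?id.
  case: i ui => -[|i] /= id ui; first by rewrite (negbTE ui).
  by move: ui; rewrite upS negbK => ->; rewrite id.
- move=> i /(congr1 val)/=; rewrite /f /c; case: (boolP (up i)) => [ui|ui].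
    case: ifP => [_ /esym/n_Sn//|id _]; right.
    have -> : i.+1 = d by apply/eqP; rewrite eqn_leq ltn_ord leqNgt id.
    by rewrite divff// gt_eqF.
  by case: i ui => -[|i] /= id ui e; left; [rewrite mul0r|case: (n_Sn i)].
- move=> i; rewrite -val_eqE /= /f /c /=; rewrite /f.
  case: (boolP (up i)) => [ui|ui].
    by case: (boolP (i.+1 < d)%N) => [id|_]; rewrite ?eqxx// upS ui opprK.
  case: i ui => -[|i] /= id ui; first by [].
  by move: ui; rewrite upS negbK => ->.
move=> i; rewrite /c; case: ifP => _.
  by rewrite normrN ger0_norm ?divr_ge0// ler_pdivrMr// mul1r ler_nat.
by rewrite ger0_norm ?divr_ge0// ler_pdivrMr// mul1r ler_nat ltnW.
Qed.

Lemma orth_projection0 d : orth_projection (0 : 'M[R]_d).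
Proof. by split; rewrite ?trmx0 ?mul0mx. Qed.

Lemma orth_projection1 d : orth_projection (1%:M : 'M[R]_d).
Proof. by split; rewrite ?trmx1 ?mul1mx. Qed.

(** Four projections add up to the scalar 2 - 1/d; identities and zeros fill
    the remaining places. *)
Lemma scalar_sum_projections (m k d : nat) : (4 + k <= m)%N -> (0 < d)%N ->
  exists P : 'I_m -> 'M[R]_d, (forall s, orth_projection (P s)) /\
    \sum_s P s = ((2 + k)%:R - d%:R^-1)%:M.
Proof.
move=> km d0; have dR : (d%:R : R) != 0 by rewrite pnatr_eq0 -lt0n.
have [P [Q [pP pQ PQ]]] := chain_projections false d0.
have [P' [Q' [pP' pQ' PQ']]] := chain_projections true d0.
pose s := [:: P; Q; P'; Q'] ++ nseq k 1%:M.
exists (fun i => nth 0 s i); split.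
  move=> i; have [si|si] := ltnP i (size s); last by rewrite nth_default//; exact: orth_projection0.
  move: (mem_nth 0 si); rewrite !inE => /or4P[/eqP->|/eqP->|/eqP->|] //.
  by move=> /orP[/eqP->//|/nseqP[-> _]]; exact: orth_projection1.
have ss : (size s <= m)%N by rewrite size_cat size_nseq.
rewrite -(big_mkord xpredT (nth 0 s)) (big_cat_nat (n := size s))//=.
rewrite [X in _ + X]big_nat_cond [X in _ + X]big1 ?addr0; last first.
  by move=> i /andP[/andP[si _] _]; rewrite nth_default.
have -> : \sum_(0 <= i < size s) nth 0 s i = \sum_(x <- s) x by rewrite [RHS](big_nth 0).
rewrite /s big_cat /= big_nseq /= iter_addr addr0.
rewrite !big_cons big_nil addr0 [P + _]addrA PQ PQ'.
apply/matrixP => i j; rewrite !(mulmxnE, mxE); case: (i == j) => /=; last first.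
  by rewrite !mulr0n mul0rn !mul0r !addr0.
by rewrite !mulr1n !mul1r addbT addbF natrD; case: (odd i) => /=; rewrite -natr1; field.
Qed.

End SumsOfProjections.

(** * Commuting squares of matrix algebras *)

Section MatrixSquares.
Context {R : realType} (r : nat).
Local Notation C := R[i].
Implicit Types (X Y : 'M[C]_r) (S : set 'M[C]_r).

Definition matrix_star_algebra S :=
  [/\ S 1%:M, forall c X Y, S X -> S Y -> S (c *: X + Y),
      forall X Y, S X -> S Y -> S (X *m Y) & forall X, S X -> S (adjmx X)].

Lemma adjmxK X : adjmx (adjmx X) = X.
Proof. by apply/matrixP => i j; rewrite !mxE conjCK. Qed.

Lemma adjmxM X Y : adjmx (X *m Y) = adjmx Y *m adjmx X.
Proof. by rewrite /adjmx trmx_mul map_mxM. Qed.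

(** The entrywise inner product of matrices is tr (X Y^* ), so orthonormal
    matrices are the rows of a multiple of a unitary matrix. *)
Lemma orthonormal_span (L : finType) (g : L -> 'M[C]_r) :
  #|L| = (r * r)%N -> (forall x y, ntr (adjmx (g x) *m g y) = (x == y)%:R) ->
  forall X, exists c : L -> C, X = \sum_l c l *: g l.
Proof.
move=> cardL gon X.
have [r0|r0] := posnP r.
  exists (fun=> 0); apply/matrixP => i; have := ltn_ord i.
  by rewrite {2}r0.
have rC : (r%:R : C) != 0 by rewrite pnatr_eq0 -lt0n.
pose ev (k : 'I_(r * r)) : L := enum_val (cast_ord (esym cardL) k).
have evbij : bijective ev.
  exists (fun l => cast_ord cardL (enum_rank l)) => l; rewrite /ev.
    by rewrite enum_valK cast_ordKV.
  by rewrite cast_ordK enum_rankK.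
pose U : 'M[C]_(r * r) := \matrix_k mxvec (g (ev k)).
have UU : U *m adjmx U = r%:R%:M.
  apply/matrixP => k l; rewrite !mxE.
  have -> : \sum_j U k j * adjmx U j l = \tr (adjmx (g (ev l)) *m g (ev k)).
    rewrite (reindex (uncurry (@mxvec_index r r))); last exact: curry_mxvec_bij.
    rewrite mxtrace_mulC /mxtrace.
    under [RHS]eq_bigr => i _ do rewrite mxE.
    rewrite pair_bigA; apply: eq_bigr => -[i j] _ /=.
    by rewrite !mxE !mxvecE.
  have := gon (ev l) (ev k); rewrite /ntr => /(canRL (mulfVK rC)) ->.
  by rewrite (inj_eq (bij_inj evbij)) eq_sym mulr_natl.
have Uu : U \in unitmx.
  have [] // := @mulmx1_unit _ _ U (r%:R^-1 *: adjmx U).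
  by rewrite -scalemxAr UU scale_scalar_mx mulVf.
have [f fK Kf] := evbij.
exists (fun l => (mxvec X *m invmx U) 0 (f l)).
rewrite (reindex ev) /=; last exact: onW_bij.
rewrite -[LHS]mxvecK -[in LHS](mulmxKV Uu (mxvec X)) mulmx_sum_row linear_sum /=.
by apply: eq_bigr => k _; rewrite linearZ /= rowK mxvecK fK.
Qed.

Record square_bases (SA SB : set 'M[C]_r) (I J : finType)
    (fa : I -> 'M[C]_r) (fb : J -> 'M[C]_r) : Prop := SquareBases {
  sb_A : matrix_star_algebra SA;
  sb_B : matrix_star_algebra SB;
  sb_a : forall i, SA (fa i);
  sb_b : forall j, SB (fb j);
  sb_spanA : forall X, SA X -> exists c : I -> C, X = \sum_i c i *: fa i;
  sb_spanB : forall Y, SB Y -> exists c : J -> C, Y = \sum_j c j *: fb j;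
  sb_on_a : forall i i', ntr (adjmx (fa i) *m fa i') = (i == i')%:R;
  sb_on_b : forall j j', ntr (adjmx (fb j) *m fb j') = (j == j')%:R;
  sb_square : forall X Y, SA X -> SB Y -> ntr (X *m Y) = ntr X * ntr Y;
  sb_card : (#|I| * #|J|)%N = (r * r)%N }.

(** The products a_i b_j are orthonormal by the commuting square condition,
    so the equality of dimensions makes the square nondegenerate. *)
Lemma square_nondeg SA SB I J fa fb : @square_bases SA SB I J fa fb ->
  forall X, exists c : I -> J -> C, X = \sum_i fa i *m (\sum_j c i j *: fb j).
Proof.
move=> sq X.
have [||c ->] := @orthonormal_span (I * J)%type (fun ij => fa ij.1 *m fb ij.2) _ _ X.
- by rewrite card_prod (sb_card sq).
- move=> [i j] [i' j'] /=.
  have [_ _ AM Aa] := sb_A sq; have [_ _ BM Ba] := sb_B sq.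
  rewrite adjmxM -mulmxA ntrC -!mulmxA mulmxA (sb_square sq); last 2 first.
  + by apply: AM; [apply: Aa|]; exact: sb_a sq _.
  + by apply: BM; [|apply: Ba]; exact: sb_b sq _.
  by rewrite [ntr (fb _ *m _)]ntrC (sb_on_a sq) (sb_on_b sq) xpair_eqE -natrM mulnb.
exists (fun i j => c (i, j)).
transitivity (\sum_i \sum_j c (i, j) *: (fa i *m fb j)).
  by rewrite pair_bigA; apply: eq_bigr => -[].
apply: eq_bigr => i _; rewrite mulmx_sumr; apply: eq_bigr => j _.
by rewrite scalemxAr.
Qed.

End MatrixSquares.

Section FramedFromSquare.
Context {R : realType} {H : completeNormedModType R[i]}.
Variable dot : {dot H for (@Num.conj R[i])}.
Hypothesis Hdot : norm_of_dot dot.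
Local Notation C := R[i].
Variables (Om : H) (r : nat).

Lemma image_star_algebra (pi : 'M[C]_r -> op H) (S : set 'M[C]_r) :
  star_embedding dot pi -> matrix_star_algebra S ->
  subalgebra (pi @` S) /\ star_closed dot (pi @` S).
Proof.
move=> [piadj pilin piM pi1 _] [S1 Sl SM Sadj]; split; first split.
- by exists 1%:M.
- by move=> c _ _ [X SX <-] [Y SY <-]; exists (c *: X + Y); [exact: Sl|exact: pilin].
- by move=> _ _ [X SX <-] [Y SY <-]; exists (X *m Y); [exact: SM|exact: piM].
move=> _ [X SX <-]; have [bX adX] := piadj X; split=> //.
by exists (pi (adjmx X)) => //; exists (adjmx X) => //; exact: Sadj.
Qed.

Lemma star_embedding_sum (pi : 'M[C]_r -> op H) (K : finType) (c : K -> C) g :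
  star_embedding dot pi ->
  pi (\sum_i c i *: g i) = (fun h => \sum_i c i *: pi (g i) h).
Proof.
move=> [_ pilin _ _ _]; elim: (index_enum K) => [|i s IH].
  have := pilin (-1) 0 0; rewrite scaler0 addr0 big_nil => ->.
  by apply/funext => h; rewrite scaleN1r addNr big_nil.
by rewrite big_cons pilin IH; apply/funext => h; rewrite big_cons.
Qed.

(** The matrix algebra A_1 has only one trace, so the vector state is ntr there
    and the matrix hypotheses become hypotheses on Om. *)
Lemma framed_tower_of_square (SA SB : set 'M[C]_r) A B e (I J : finType)
    (fa : I -> 'M[C]_r) (fb : J -> 'M[C]_r) :
  square_tower dot Om SA SB A B e -> square_bases SA SB fa fb ->
  exists (pi : 'M[C]_r -> op H) (lam : C),
    [/\ star_embedding dot pi, A 0%N = pi @` SA,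
        forall X, vec_trace dot Om (pi X) = ntr X &
        framed_tower dot Om (fun i => pi (fa i)) (fun i => pi (adjmx (fa i)))
          (fun j => pi (fb j)) (fun j => pi (adjmx (fb j))) A B e lam].
Proof.
case=> [[pi Hpi [A0 A1 B0 B1]] tproj tbcA tB tgns [lam tmarkov]] sq.
have [piadj pilin piM pi1 _] := Hpi.
have [Om1 trc _] := tgns.
have ntau X : vec_trace dot Om (pi X) = ntr X.
  apply: (trace_unique (F := fun X => vec_trace dot Om (pi X))) => [c Z Y|Z Y|].
  - by rewrite pilin /vec_trace dotPl.
  - by rewrite !piM; apply: trc; exists 1%N => //; rewrite A1; [exists Z|exists Y].
  - by rewrite pi1 /vec_trace -Hdot Om1 expr1n.
exists pi, lam; split=> //.
have [subA0 starA0] := image_star_algebra Hpi (sb_A sq).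
have [subB1 starB1] := image_star_algebra Hpi (sb_B sq).
have [subA1 starA1] : subalgebra (range pi) /\ star_closed dot (range pi).
  exact: image_star_algebra Hpi _.
have [_ _ _ Aadj] := sb_A sq; have [_ Bl _ Badj] := sb_B sq.
have A01 : pi @` SA `<=` range pi by move=> _ [X _ <-]; exists X.
have BA1 : pi @` SB `<=` range pi by move=> _ [X _ <-]; exists X.
split=> //; rewrite ?A0 ?A1 ?B0 ?B1 //.
- move=> _ [X /(sb_spanA sq)[c ->] <-]; exists c; exact: star_embedding_sum.
- by move=> x; split=> [[c _ <-]|[c ->]]; exists c.
- move=> i; split; [exists (fa i) => //; exact: sb_a sq i|
    exists (adjmx (fa i)) => //; exact/Aadj/(sb_a sq)|].
  by case: (piadj (fa i)).
- move=> j; split; [exists (fb j) => //; exact: sb_b sq j|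
    exists (adjmx (fb j)) => //; exact/Badj/(sb_b sq)|].
  by case: (piadj (fb j)).
- move=> _ [X /(sb_spanB sq)[c ->] <-]; exists c; exact: star_embedding_sum.
- by move=> i j; rewrite -piM ntau (sb_on_a sq).
- by move=> i j; rewrite -piM ntau (sb_on_b sq).
- by move=> _ _ [X SX <-] [Y SY <-]; rewrite -piM !ntau (sb_square sq).
- move=> _ [X _ <-]; have [c ->] := square_nondeg sq X.
  exists (fun i => pi (\sum_j c i j *: fb j)) => [i|].
    exists (\sum_j c i j *: fb j) => //.
    have B0' : SB 0.
      have [S1 _ _ _] := sb_B sq.
      by have := Bl (-1) _ _ S1 S1; rewrite scaleN1r addNr.
    elim: (index_enum J) => [|j s IH]; first by rewrite big_nil.
    by rewrite big_cons; apply: Bl => //; exact: sb_b sq j.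
  have := star_embedding_sum (fun=> 1) (fun i => fa i *m (\sum_j c i j *: fb j)) Hpi.
  under eq_bigr => i _ do rewrite scale1r.
  move=> ->; apply/funext => h; apply: eq_bigr => i _.
  by rewrite scale1r piM.
Qed.

End FramedFromSquare.

(** * Orthonormal bases of matrix algebras *)

Section OrthonormalBases.
Context {R : realType}.
Local Notation C := R[i].

Definition ortho_basis r (S : set 'M[C]_r) (I : finType) (f : I -> 'M[C]_r) :=
  [/\ matrix_star_algebra S, forall i, S (f i),
      forall X, S X -> exists c : I -> C, X = \sum_i c i *: f i &
      forall i j, ntr (adjmx (f i) *m f j) = (i == j)%:R].

Lemma square_bases_of_ortho r (SA SB : set 'M[C]_r) (I J : finType) fa fb :
  ortho_basis SA fa -> ortho_basis SB fb ->
  (forall X Y, SA X -> SB Y -> ntr (X *m Y) = ntr X * ntr Y) ->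
  (#|I| * #|J|)%N = (r * r)%N -> @square_bases R r SA SB I J fa fb.
Proof. by case=> ? ? ? ? [] *; split. Qed.

Definition trace_hom s r (phi : 'M[C]_s -> 'M[C]_r) :=
  [/\ forall c X Y, phi (c *: X + Y) = c *: phi X + phi Y,
      forall X Y, phi (X *m Y) = phi X *m phi Y, phi 1%:M = 1%:M,
      forall X, phi (adjmx X) = adjmx (phi X) & forall X, ntr (phi X) = ntr X].

Lemma ortho_basis_image s r (phi : 'M[C]_s -> 'M[C]_r) (S : set 'M[C]_s)
    (I : finType) (f : I -> 'M[C]_s) :
  trace_hom phi -> ortho_basis S f -> ortho_basis (phi @` S) (phi \o f).
Proof.
move=> [pl pM p1 pa pt] [[S1 Sl SM Sa] Sf span on]; split.
- split.
  + by exists 1%:M.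
  + by move=> c _ _ [X SX <-] [Y SY <-]; exists (c *: X + Y) => //; exact: Sl.
  + by move=> _ _ [X SX <-] [Y SY <-]; exists (X *m Y) => //; exact: SM.
  + by move=> _ [X SX <-]; exists (adjmx X) => //; exact: Sa.
- by move=> i; exists (f i).
- move=> _ [X /span[c ->] <-]; exists c.
  have p0 : phi 0 = 0.
    by have := pl (-1) 0 0; rewrite scaler0 addr0 => ->; rewrite scaleN1r addNr.
  elim: (index_enum I) => [|i t IH]; first by rewrite !big_nil.
  by rewrite !big_cons pl IH.
by move=> i j /=; rewrite -pa -pM pt on.
Qed.

Lemma adjmx1 r : adjmx (1%:M : 'M[C]_r) = 1%:M.
Proof. by rewrite /adjmx trmx1 map_mx1. Qed.

Lemma Ad_trace_hom r (u : 'M[C]_r) : unitary_mx u -> trace_hom (Ad u).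
Proof.
move=> [uu uu']; split=> [c X Y|X Y||X|X]; rewrite /Ad.
- by rewrite mulmxDr mulmxDl -scalemxAr -scalemxAl.
- by rewrite !mulmxA; congr (_ *m _ *m _); rewrite -!mulmxA uu' mulmx1.
- by rewrite mulmx1.
- by rewrite !adjmxM adjmxK mulmxA.
by rewrite ntrC mulmxA uu' mul1mx.
Qed.

(** The factor that makes the matrix units of M_n orthonormal for ntr. *)
Definition root_dim (n : nat) : C := sqrtC n%:R.

Lemma root_dimK n : root_dim n * (root_dim n)^* = n%:R.
Proof.
have r0 : 0 <= root_dim n by rewrite sqrtC_ge0 ler0n.
by rewrite (geC0_conj r0) -expr2 sqrtCK.
Qed.

Lemma adjmx_delta r (i j : 'I_r) : adjmx (delta_mx i j : 'M[C]_r) = delta_mx j i.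
Proof. by apply/matrixP => a b; rewrite !mxE andbC rmorph_nat. Qed.

Lemma ntr_scaled_delta r (i j i' j' : 'I_r) :
  ntr (adjmx (root_dim r *: delta_mx i j) *m (root_dim r *: delta_mx i' j'))
  = ((i == i') && (j == j'))%:R.
Proof.
have r0 : (r%:R : C) != 0 by rewrite pnatr_eq0 -lt0n (leq_ltn_trans _ (ltn_ord i)).
have -> : adjmx (root_dim r *: delta_mx i j : 'M[C]_r) = (root_dim r)^* *: delta_mx j i.
  by apply/matrixP => a b; rewrite !mxE rmorphM rmorph_nat andbC.
rewrite -scalemxAl -scalemxAr scalerA mulrC root_dimK ntrZ.
rewrite /ntr; have [<-|ii'] := eqVneq i i'; last first.
  by rewrite mul_delta_mx_0// mxtrace0 mul0r mulr0.
rewrite mul_delta_mx /mxtrace (bigD1 j)//= big1 ?addr0 => [|l lj]; last first.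
  by rewrite mxE (negbTE lj).
by rewrite mxE eqxx /= mulrC divfK.
Qed.

Lemma full_ortho_basis r : ortho_basis [set: 'M[C]_r]
  (fun ij : 'I_r * 'I_r => root_dim r *: delta_mx ij.1 ij.2).
Proof.
split=> // [X _|[i j] [i' j']]; last by rewrite ntr_scaled_delta xpair_eqE.
exists (fun ij => X ij.1 ij.2 / root_dim r).
rewrite {1}(matrix_sum_delta X) pair_bigA; apply: eq_bigr => -[i j] _ /=.
have r0 : root_dim r != 0.
  by rewrite sqrtC_eq0 pnatr_eq0 -lt0n (leq_ltn_trans _ (ltn_ord i)).
by rewrite scalerA divfK.
Qed.

Lemma diagonal_mxsP r (X : 'M[C]_r) :
  diagonal_mxs X <-> forall i j, i != j -> X i j = 0.
Proof.
split=> [/is_diag_mxP dX i j ij|dX]; first exact: dX.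
by apply/is_diag_mxP => i j ij; exact: dX.
Qed.

Lemma diag_ortho_basis r : ortho_basis (@diagonal_mxs R r)
  (fun i : 'I_r => root_dim r *: delta_mx i i).
Proof.
split=> [|i|X /diagonal_mxsP dX|i j].
- split=> [|c X Y /diagonal_mxsP dX /diagonal_mxsP dY|X Y /diagonal_mxsP dX /diagonal_mxsP dY|X /diagonal_mxsP dX];
    apply/diagonal_mxsP => i j ij; rewrite !mxE.
  + by rewrite (negbTE ij).
  + by rewrite dX// dY// mulr0 addr0.
  + by rewrite big1// => l _; have [<-|il] := eqVneq i l; [rewrite dY// mulr0|rewrite dX// mul0r].
  + by rewrite dX ?conjC0// eq_sym.
- apply/diagonal_mxsP => a b ab; rewrite !mxE; case: (eqVneq a i) => [<-|]; last by rewrite mulr0.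
  by rewrite eq_sym (negbTE ab) mulr0.
- exists (fun i => X i i / root_dim r).
  rewrite {1}(matrix_sum_delta X); apply: eq_bigr => i _.
  have r0 : root_dim r != 0.
    by rewrite sqrtC_eq0 pnatr_eq0 -lt0n (leq_ltn_trans _ (ltn_ord i)).
  rewrite (bigD1 i)//= big1 ?addr0 => [|j ji]; first by rewrite scalerA divfK.
  by rewrite dX ?scale0r// eq_sym.
by rewrite ntr_scaled_delta andbb.
Qed.

(** * Hadamard matrices *)

(** tr (x u z u^* ) is the sum of x_i |u_ij|^2 z_j, and all |u_ij|^2 are 1/m. *)
Lemma hadamard_square m (u : 'M[C]_m) X Y : complex_hadamard u ->
  diagonal_mxs X -> (Ad u @` @diagonal_mxs R m) Y -> ntr (X *m Y) = ntr X * ntr Y.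
Proof.
move=> [uu mod_u] /diagonal_mxsP dX [Z /diagonal_mxsP dZ <-].
have [_ _ _ _ ->] := Ad_trace_hom uu.
have u2 i j : u i j * (u i j)^* = m%:R^-1.
  rewrite -normCK mod_u -rmorphXn /= exprVn sqr_sqrtr ?ler0n//.
  by rewrite fmorphV rmorph_nat.
have -> : ntr (X *m Ad u Z) = (\sum_i \sum_j X i i * Z j j * m%:R^-1) / m%:R.
  congr (_ / _); apply: eq_bigr => i _; rewrite mxE (bigD1 i)//= big1 ?addr0 => [|j ji].
    rewrite mxE mulr_sumr; apply: eq_bigr => j _; rewrite mxE (bigD1 j)//= big1 ?addr0 => [|l lj].
      by rewrite !mxE mulrAC u2; ring.
    by rewrite dZ// mulr0.
  by rewrite dX ?mul0r// eq_sym.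
rewrite /ntr /mxtrace; under eq_bigr => i _ do rewrite -mulr_suml -mulr_sumr.
by rewrite -!mulr_suml; ring.
Qed.

Lemma spin_bases m (u : 'M[C]_m) : complex_hadamard u ->
  square_bases (@diagonal_mxs R m) (Ad u @` @diagonal_mxs R m)
    (fun i : 'I_m => root_dim m *: delta_mx i i)
    (Ad u \o (fun i : 'I_m => root_dim m *: delta_mx i i)).
Proof.
move=> hu; apply: square_bases_of_ortho; first exact: diag_ortho_basis.
- by apply: ortho_basis_image (diag_ortho_basis m); apply: Ad_trace_hom; case: hu.
- by move=> X Y; exact: hadamard_square.
by rewrite card_ord.
Qed.

(** * Biunitary matrices *)

Section Tensor.
Variables l k : nat.
Hypotheses (l0 : (0 < l)%N) (k0 : (0 < k)%N).
Local Notation tens := mxtens.tensmx.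
Local Notation idx := (@mxtens.mxtens_index l k).

Lemma idx_bij : bijective idx.
Proof.
by exists (@mxtens.mxtens_unindex l k); [exact: mxtens.mxtens_indexK|exact: mxtens.mxtens_unindexK].
Qed.

Lemma sum_idx (F : 'I_(l * k) -> C) : \sum_p F p = \sum_i \sum_j F (idx (i, j)).
Proof. by rewrite (reindex idx) ?pair_bigA; [apply: eq_bigr => -[]|exact/onW_bij/idx_bij]. Qed.

Lemma ntr_tens (X : 'M[C]_l) (Y : 'M[C]_k) : ntr (tens X Y) = ntr X * ntr Y.
Proof.
rewrite /ntr /mxtrace sum_idx.
under eq_bigr => i _.
  under eq_bigr => j _ do rewrite mxtens.tensmxE.
  rewrite -mulr_sumr; over.
by rewrite -mulr_suml natrM invfM mulrACA.
Qed.

Lemma adjmx_tens (X : 'M[C]_l) (Y : 'M[C]_k) : adjmx (tens X Y) = tens (adjmx X) (adjmx Y).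
Proof. by rewrite /adjmx mxtens.trmx_tens mxtens.map_mxT. Qed.

Lemma tens11 : tens (1%:M : 'M[C]_l) (1%:M : 'M[C]_k) = 1%:M.
Proof.
apply/matrixP => p q.
rewrite -(mxtens.mxtens_unindexK p) -(mxtens.mxtens_unindexK q).
case: (mxtens.mxtens_unindex p) => i j; case: (mxtens.mxtens_unindex q) => i' j'.
by rewrite mxtens.tensmxE !mxE (inj_eq (bij_inj idx_bij)) xpair_eqE -natrM mulnb.
Qed.

Lemma ntr1 n : (0 < n)%N -> ntr (1%:M : 'M[C]_n) = 1.
Proof. by move=> n0; rewrite /ntr mxtrace1 divff// pnatr_eq0 -lt0n. Qed.

Lemma tens_right_hom : trace_hom (tens (1%:M : 'M[C]_l) : 'M[C]_k -> 'M[C]_(l * k)).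
Proof.
split=> [c X Y|X Y||X|X].
- by apply/matrixP => p q; rewrite !mxE mulrDr mulrCA.
- by rewrite mxtens.tensmx_mul mul1mx.
- exact: tens11.
- by rewrite adjmx_tens adjmx1.
by rewrite ntr_tens ntr1// mul1r.
Qed.

Lemma tens_left_hom : trace_hom (fun X : 'M[C]_l => tens X (1%:M : 'M[C]_k)).
Proof.
split=> [c X Y|X Y||X|X].
- by apply/matrixP => p q; rewrite !mxE mulrDl mulrA.
- by rewrite mxtens.tensmx_mul mul1mx.
- exact: tens11.
- by rewrite adjmx_tens adjmx1.
by rewrite ntr_tens ntr1// mulr1.
Qed.

(** The trace of (1 (x) Y) v (X (x) 1) v^* pairs the rows of the block
    transpose of v with each other. *)
Lemma biunitary_square (v : 'M[C]_(l * k)) (X : 'M[C]_l) (Y : 'M[C]_k) :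
  bi_unitary v -> ntr (tens 1%:M Y *m Ad v (tens X 1%:M)) = ntr Y * ntr X.
Proof.
move=> [_ [vv _]].
have vE b b' a a' : \sum_i \sum_j v (idx (i, a)) (idx (b, j)) * (v (idx (i, a')) (idx (b', j)))^*
    = (b == b')%:R * (a == a')%:R.
  have /matrixP/(_ (idx (b, a)) (idx (b', a'))) := vv.
  rewrite mxE sum_idx [in RHS]mxE (inj_eq (bij_inj idx_bij)) xpair_eqE -natrM mulnb => <-.
  by apply: eq_bigr => i _; apply: eq_bigr => j _; rewrite !mxE !mxtens.mxtens_indexK.
rewrite /ntr natrM invfM mulrACA; congr (_ * _); rewrite ?[k%:R^-1 * _]mulrC //.
have T1E i a q : (tens 1%:M Y *m v) (idx (i, a)) q = \sum_a' Y a a' * v (idx (i, a')) q.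
  rewrite mxE sum_idx (bigD1 i)//= [X in _ + X]big1 ?addr0 => [|i' ii'].
    by apply: eq_bigr => a' _; rewrite mxtens.tensmxE mxE eqxx mul1r.
  by apply: big1 => a' _; rewrite mxtens.tensmxE mxE eq_sym (negbTE ii') !mul0r.
have T2E b j p : (tens X 1%:M *m adjmx v) (idx (b, j)) p =
    \sum_b' X b b' * (v p (idx (b', j)))^*.
  rewrite mxE sum_idx; apply: eq_bigr => b' _; rewrite (bigD1 j)//= big1 ?addr0 => [|j' jj'].
    by rewrite mxtens.tensmxE !mxE eqxx mulr1.
  by rewrite mxtens.tensmxE [_%:M j j']mxE eq_sym (negbTE jj') mulr0 mul0r.
have -> : tens 1%:M Y *m Ad v (tens X 1%:M) = (tens 1%:M Y *m v) *m (tens X 1%:M *m adjmx v).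
  by rewrite /Ad !mulmxA.
rewrite /mxtrace sum_idx exchange_big /= mulr_suml.
apply: eq_bigr => a _; rewrite mulr_sumr.
transitivity (\sum_i \sum_b \sum_j (\sum_a' Y a a' * v (idx (i, a')) (idx (b, j))) *
    (\sum_b' X b b' * (v (idx (i, a)) (idx (b', j)))^*)).
  apply: eq_bigr => i _; rewrite mxE sum_idx; apply: eq_bigr => b _; apply: eq_bigr => j _.
  by rewrite T1E T2E.
rewrite exchange_big /=; apply: eq_bigr => b _.
transitivity (\sum_(p : 'I_l * 'I_k) \sum_(s : 'I_k * 'I_l) Y a s.1 * X b s.2 *
    (v (idx (p.1, s.1)) (idx (b, p.2)) * (v (idx (p.1, a)) (idx (s.2, p.2)))^*)).
  rewrite pair_bigA; apply: eq_bigr => -[i j] _ /=.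
  rewrite big_distrlr /= pair_bigA; apply: eq_bigr => -[a' b'] _ /=; ring.
rewrite exchange_big /= (bigD1 (a, b))//= [X in _ + X]big1 ?addr0 => [|[a' b'] ab].
  by rewrite -mulr_sumr -(pair_bigA _ (fun i j => v (idx (i, a)) (idx (b, j)) *
      (v (idx (i, a)) (idx (b, j)))^*)) /= vE !eqxx !mulr1.
rewrite -mulr_sumr -(pair_bigA _ (fun i j => v (idx (i, a')) (idx (b, j)) *
    (v (idx (i, a)) (idx (b', j)))^*)) /= vE -natrM mulnb.
by move: ab; rewrite xpair_eqE andbC [b' == b]eq_sym => /negbTE ->; rewrite mulr0.
Qed.

Lemma vertex_bases (v : 'M[C]_(l * k)) : bi_unitary v ->
  square_bases
    [set tens (1%:M : 'M[C]_l) Y | Y in [set: 'M[C]_k]]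
    (Ad v @` [set tens X (1%:M : 'M[C]_k) | X in [set: 'M[C]_l]])
    (tens (1%:M : 'M[C]_l) \o (fun ij : 'I_k * 'I_k => root_dim k *: delta_mx ij.1 ij.2))
    (Ad v \o ((fun X : 'M[C]_l => tens X (1%:M : 'M[C]_k)) \o
       (fun ij : 'I_l * 'I_l => root_dim l *: delta_mx ij.1 ij.2))).
Proof.
move=> bv; apply: square_bases_of_ortho.
- exact: ortho_basis_image tens_right_hom (full_ortho_basis k).
- apply: ortho_basis_image; first by apply: Ad_trace_hom; case: bv.
  exact: ortho_basis_image tens_left_hom (full_ortho_basis l).
- move=> _ _ [Y _ <-] [_ [X _ <-] <-]; rewrite (biunitary_square _ _ bv).
  have [_ _ _ _ ->] := Ad_trace_hom bv.1.
  have [_ _ _ _ ->] := tens_left_hom; have [_ _ _ _ ->] := tens_right_hom.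
  by [].
by rewrite !card_prod !card_ord; nia.
Qed.

End Tensor.
End OrthonormalBases.

(** * Spin and vertex model subfactors *)

Section SquareSubfactors.
Context {R : realType} {H : completeNormedModType R[i]}.
Variable dot : {dot H for (@Num.conj R[i])}.
Hypothesis Hdot : norm_of_dot dot.
Local Notation C := R[i].
Variables (Om : H) (r : nat) (SA SB : set 'M[C]_r) (M N : set (op H)).
Hypothesis sub : square_subfactor dot Om SA SB M N.

Lemma square_dim_gt0 : (0 < r)%N.
Proof.
have [A [B [e [[[pi [_ pilin _ pi1 _] _] _ _ _ [Om1 _ _] _] _ _]]]] := sub.
rewrite lt0n; apply/eqP => r0; have e10 : (1%:M : 'M[C]_r) = 0.
  by apply/matrixP => i; have := ltn_ord i; rewrite {2}r0.
have := pilin (-1) 1%:M 1%:M; rewrite {1}e10 scaler0 add0r.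
move=> /(congr1 (fun f => f Om)); rewrite scaleN1r addNr pi1 /= => Om0.
by move: Om1; rewrite Om0 normr0 => /esym/eqP; rewrite oner_eq0.
Qed.

Variables (I J : finType) (fa : I -> 'M[C]_r) (fb : J -> 'M[C]_r).
Hypothesis sq : square_bases SA SB fa fb.

Lemma square_index c : jones_index dot Om M N c -> c = #|I|%:R.
Proof.
have [A [B [e [tow -> ->]]]] := sub; move=> [_ cc].
have [pi [lam [_ _ _ T]]] := framed_tower_of_square Hdot tow sq.
have [s [s' [sP sE s'E]]] := right_mults Hdot T.
have [p [bp ap pE]] := vacuum_projection Hdot T.
exact: (framed_coupling_constant Hdot T sP sE s'E bp ap pE cc).
Qed.

Lemma square_Lambda m (pr : 'I_m -> 'M[C]_r) k K :
  (0 < #|J|)%N -> (4 + k <= m)%N ->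
  (forall s, SA (pr s) /\ adjmx (pr s) = pr s) ->
  (forall s s', pr s *m pr s' = (s == s')%:R *: pr s) ->
  (forall s, ntr (pr s) = m%:R^-1) ->
  Lambda dot Om M N (((2 + k)%:R - (#|J| ^ K.+1)%:R^-1) / m%:R).
Proof.
move=> J0 km prA prM prt.
have [A [B [e [tow -> ->]]]] := sub.
have [pi [lam [[piadj pilin piM pi1 _] A0 ntau T]]] := framed_tower_of_square Hdot tow sq.
have d0 : (0 < #|J| ^ K.+1)%N by rewrite expn_gt0 J0.
have [P [PP sumP]] := @scalar_sum_projections R m k _ km d0.
have pi0 : pi 0 = (fun=> 0).
  by have := pilin (-1) 0 0; rewrite scaler0 addr0 => ->; apply/funext => h; rewrite scaleN1r addNr.
apply: (projections_Lambda Hdot T (g := fun s => pi (pr s)) (erefl _) _ _ _ PP sumP).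
- move=> s; have [As prs] := prA s; split; first by rewrite A0; exists (pr s).
  by have [_] := piadj (pr s); rewrite prs.
- move=> s s' h; have := piM (pr s) (pr s'); rewrite prM.
  case: (s == s'); rewrite ?scale1r ?scale0r ?pi0 => /(congr1 (fun f => f h)) /= <- //.
- by move=> s; rewrite ntau prt.
have m0 : 0 < m%:R :> R by rewrite ltr0n; lia.
set d : R := (#|J| ^ K.+1)%:R^-1.
have dge0 : 0 <= d by rewrite invr_ge0 ler0n.
have dle1 : d <= 1 by rewrite invf_le1 ?ltr0n// ler1n.
have km' : 4 + k%:R <= m%:R :> R by rewrite -natrD ler_nat.
have k0 : 0 <= k%:R :> R by rewrite ler0n.
rewrite natrD; apply/andP; split.
  by rewrite divr_ge0 ?ltW//; lra.
by rewrite ler_pdivrMr// mul1r; lra.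
Qed.

End SquareSubfactors.

(** The bound 1 < D gives the first term the numerator 2 + k - 1/D >= 3/2, which
    already lies above t. *)
Lemma increasing_scalars (R : realType) (L : set R) (t : R) (m k D : nat) :
  (1 < D)%N -> (4 + k <= m)%N -> (6 <= m)%N -> 0 < t < 1 / 2%:R ->
  t * (1 - t) <= m%:R^-1 ->
  (forall K, L (((2 + k)%:R - (D ^ K.+1)%:R^-1) / m%:R)) ->
  increasing_seq_to L t ((2 + k)%:R / m%:R).
Proof.
move=> D1 km m6 /andP[t0 t2] tm LK.
have m0 : 0 < m%:R :> R by rewrite ltr0n; lia.
exists (fun K => ((2 + k)%:R - (D ^ K.+1)%:R^-1) / m%:R); split.
- move=> K; rewrite ltr_pM2r ?invr_gt0// ltrD2l ltrN2.
  by rewrite ltf_pV2 ?posrE ?ltr0n ?expn_gt0 ?(ltnW D1)// ltr_nat ltn_exp2l.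
- move=> K; split=> //.
  set d : R := (D ^ K.+1)%:R^-1.
  have d0 : 0 < d by rewrite invr_gt0 ltr0n expn_gt0 ltnW.
  have d2 : d <= 1 / 2.
    rewrite /d div1r lef_pV2 ?posrE ?ltr0n ?expn_gt0 ?(ltnW D1)// ler_nat.
    by rewrite expnS (leq_trans D1)// leq_pmulr// expn_gt0 ltnW.
  have km' : 4 + k%:R <= m%:R :> R by rewrite -natrD ler_nat.
  have m6' : 6 <= m%:R :> R by rewrite ler_nat.
  have k0 : 0 <= k%:R :> R by rewrite ler0n.
  rewrite natrD; set b := (2 + k%:R - d).
  set x := b / m%:R; have xm : x * m%:R = b by rewrite divfK ?gt_eqF.
  have b1 : 3 / 2 <= b by rewrite /b; lra.
  have b2 : b <= m%:R - 2 by rewrite /b; lra.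
  have tm' : t * (1 - t) * m%:R <= 1 by rewrite -ler_pdivlMr// div1r.
  (* x (1 - x) > 1/m amounts to b (m - b) > m, which on [3/2, m - 2] needs m > 9/2;
     and x -> x (1 - x) exceeds its value at t only between t and 1 - t *)
  have xt : t * (1 - t) < x * (1 - x).
    rewrite -(ltr_pM2r m0) (le_lt_trans tm')// -(ltr_pM2r m0) mul1r.
    have -> : x * (1 - x) * m%:R * m%:R = b * (m%:R - b) by rewrite -xm; ring.
    nra.
  by apply/andP; split; rewrite ltNge; apply/negP => ?; nra.
have -> : (fun K => ((2 + k)%:R - (D ^ K.+1)%:R^-1) / m%:R : R) =
    (fun K => (2 + k)%:R / m%:R - D%:R^-1 ^+ K.+1 * m%:R^-1).
  by apply/funext => K; rewrite mulrBl natrX exprVn.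
have -> : nbhs ((2 + k)%:R / m%:R : R) = nbhs ((2 + k)%:R / m%:R - 0 * m%:R^-1 : R).
  by rewrite mul0r subr0.
apply: cvgB; first exact: cvg_cst.
apply: cvgMr_tmp.
have : (fun K : nat => (D%:R^-1 : R) ^+ K) @ \oo --> (0 : R).
  apply: cvg_expr.
  by rewrite ger0_norm ?invr_ge0// invf_lt1 ?ltr0n ?ltr1n// ltnW.
by rewrite -cvg_shiftS.
Qed.

Section Models.
Context {R : realType} {H : completeNormedModType R[i]}.
Variable dot : {dot H for (@Num.conj R[i])}.
Hypothesis Hdot : norm_of_dot dot.
Variables (Om : H) (M N : set (op H)) (ind t : R).
Hypothesis hind : jones_index dot Om M N ind.
Hypotheses (ht : 0 < t < 1 / 2%:R) (htind : t * (1 - t) = ind^-1).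

Lemma spin_model_limits n : (3 <= n)%N ->
  spin_model_subfactor dot Om M N -> ind = (2 * n)%:R ->
  forall i : nat, (i <= 2 * n - 4)%N ->
  increasing_seq_to (Lambda dot Om M N) t ((2 + i)%:R / ind).
Proof.
move=> hn [m [u [hu sub]]] indE i hi.
have sq := spin_bases hu.
have indm := square_index Hdot sub sq hind; rewrite card_ord in indm.
have mn : m = (2 * n)%N by apply/eqP; rewrite -(eqr_nat R) -indm indE.
have m0 : (0 < m)%N by lia.
rewrite indm; apply: (@increasing_scalars _ _ _ _ _ m) => //; try lia.
  by rewrite htind indm.
move=> K.
have := @square_Lambda _ _ _ Hdot _ _ _ _ _ _ sub _ _ _ _ sq m (fun s => delta_mx s s) i K.
rewrite card_ord; apply=> [//||s|s s'|s]; first lia.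
- split; last exact: adjmx_delta.
  apply/diagonal_mxsP => a b ab; rewrite mxE.
  by case: (eqVneq a s) ab => [->|//]; rewrite eq_sym => /negbTE ->.
- by have [<-|ss'] := eqVneq s s'; rewrite ?scale1r ?scale0r ?mul_delta_mx ?mul_delta_mx_0.
rewrite /ntr /mxtrace (bigD1 s)//= big1 ?addr0 => [|a /negbTE sa]; last first.
  by rewrite mxE sa.
by rewrite mxE eqxx mul1r.
Qed.

Lemma vertex_model_limits n : (3 <= n)%N ->
  vertex_model_subfactor dot Om M N -> ind = ((2 * n) ^ 2)%:R ->
  forall i : nat, (i <= 2 * n - 4)%N ->
  increasing_seq_to (Lambda dot Om M N) t ((2 + i)%:R / Num.sqrt ind).
Proof.
move=> hn [l [k [v [l1 [bv sub]]]]] indE i hi.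
have l0 : (0 < l)%N by exact: ltnW.
have k0 : (0 < k)%N by have := square_dim_gt0 sub; rewrite muln_gt0 => /andP[].
have sq := vertex_bases l0 k0 bv.
have indk := square_index Hdot sub sq hind; rewrite card_prod !card_ord in indk.
have kn : k = (2 * n)%N.
  by apply/eqP; rewrite -(eqn_exp2r _ _ (ltn0Sn 1)) -(eqr_nat R) -indE indk expnS expn1.
have -> : Num.sqrt ind = k%:R.
  by rewrite indk natrM -expr2 sqrtr_sqr ger0_norm.
apply: (@increasing_scalars _ _ _ _ _ (l * l)) => //; try nia.
  rewrite htind indk lef_pV2 ?posrE ?ltr0n ?muln_gt0 ?k0// ler_nat; nia.
move=> K.
have := @square_Lambda _ _ _ Hdot _ _ _ _ _ _ sub _ _ _ _ sq k
  (fun s => mxtens.tensmx 1%:M (delta_mx s s)) i K.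
rewrite card_prod !card_ord; apply=> [||s|s s'|s]; [nia|lia|..].
- by split; [exists (delta_mx s s)|rewrite adjmx_tens adjmx1 adjmx_delta].
- rewrite mxtens.tensmx_mul mul1mx.
  have [<-|ss'] := eqVneq s s'; first by rewrite mul_delta_mx scale1r.
  by rewrite mul_delta_mx_0// scale0r mxtens.tensmx0.
rewrite ntr_tens ntr1// mul1r.
rewrite /ntr /mxtrace (bigD1 s)//= big1 ?addr0 => [|a /negbTE sa]; last first.
  by rewrite mxE sa.
by rewrite mxE eqxx mul1r.
Qed.

End Models.

Unset Implicit Arguments.

Theorem theorem1p2 (R : realType) (H : completeNormedModType R[i])
    (dot : {dot H for (@Num.conj R[i])}) (Hdot : norm_of_dot dot)
    (Om : H) (M N : set (op H)) (n : nat) (hn : (3 <= n)%N)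
    (ind : R) (hind : jones_index dot Om M N ind)
    (t : R) (ht : 0 < t < 1 / 2%:R) (htind : t * (1 - t) = ind^-1) :
  (spin_model_subfactor dot Om M N -> ind = (2 * n)%:R ->
   forall i : nat, (i <= 2 * n - 4)%N ->
     increasing_seq_to (Lambda dot Om M N) t ((2 + i)%:R / ind)) /\
  (vertex_model_subfactor dot Om M N -> ind = ((2 * n) ^ 2)%:R ->
   forall i : nat, (i <= 2 * n - 4)%N ->
     increasing_seq_to (Lambda dot Om M N) t ((2 + i)%:R / Num.sqrt ind)).
Proof.
split.
  exact: (spin_model_limits Hdot hind ht htind hn).
exact: (vertex_model_limits Hdot hind ht htind hn).
Qed.
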